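(* Let $A$ be a finitely generated smooth commutative $\mathbf{C}$-algebra. Then: (a) For every integer $d\ge 0$, $A$ possesses a $d$-smooth thickening, i.e. a $d$-smooth algebra $R$ together with an isomorphism $R_{ab}\to A$. This thickening is unique up to an isomorphism identical on $A$. (b) Similarly, $A$ possesses an NC-smooth thickening (an NC-smooth algebra $R$ with an isomorphism $R_{ab}\to A$), unique up to an isomorphism identical on $A$.
   Context: All algebras are associative unital $\mathbf{C}$-algebras. For an algebra $R$, regard $R$ as a Lie algebra via $[a,b]=ab-ba$ and let $R^{\rm Lie}_1=R$, $R^{\rm Lie}_m=[R,R^{\rm Lie}_{m-1}]$ be its lower central series. The NC-filtration is $F^dR=\sum_m\sum_{i_1+\dots+i_m-m=d} R\,R^{\rm Lie}_{i_1}R\cdots R\,R^{\rm Lie}_{i_m}R$ (two-sided ideals, $F^0R=R$). $R_{ab}=R/[R,R]$ denotes the commutativization (quotient by the two-sided ideal generated by commutators). $R$ is NC-nilpotent of degree $d$ if $F^{d+1}R=0$; $R$ is NC-complete if $R\to\varprojlim_d R/F^dR$ is an isomorphism. Let $\mathcal N_d$ be the category of algebras NC-nilpotent of degree $d$. A functor $h:\mathcal N_d\to\mathrm{Sets}$ is formally smooth if for every surjection $\Lambda'\to\Lambda$ in $\mathcal N_d$ whose kernel is a nilpotent ideal, $h(\Lambda')\to h(\Lambda)$ is surjective. An algebra $R$ is $d$-smooth if $R$ is finitely generated, $F^{d+1}R=0$, and the functor $\Lambda\mapsto\mathrm{Hom}_{\rm alg}(R,\Lambda)$ on $\mathcal N_d$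 is formally smooth. $R$ is NC-smooth if it is NC-complete and $R/F^{d+1}R$ is $d$-smooth for every $d\ge0$. A smooth commutative algebra means the coordinate algebra of a smooth affine algebraic variety. *)

(* Defs.v *)
From HB Require Import structures.
From mathcomp Require Import all_boot all_order all_algebra.
From mathcomp Require Import complex reals.
Set Implicit Arguments. Unset Strict Implicit. Unset Printing Implicit Defensive.
Import Order.TTheory GRing.Theory Num.Theory.
Local Open Scope ring_scope.

(* Complex numbers: C := R[i] for a real-number type R (any realType is
   isomorphic to the reals). Associative unital C-algebras: algType C. *)

Definition surj (X Y : Type) (f : X -> Y) : Prop := forall y, exists x, f x = y.

Section NC.
Variable (K : pzRingType).

Definition alg_hom (S T : algType K) (f : S -> T) : Prop :=
  [/\ forall x y, f (x + y) = f x + f y,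
      forall (c : K) x, f (c *: x) = c *: f x,
      forall x y, f (x * y) = f x * f y
    & f 1 = 1].

Definition alg_iso (S T : algType K) (f : S -> T) : Prop :=
  alg_hom f /\ bijective f.

Variable S : algType K.

Inductive lcs : nat -> S -> Prop :=
| lcs_one x : lcs 1 x
| lcs_comm m a b : lcs m.+1 b -> lcs m.+2 (a * b - b * a)
| lcs_zero m : lcs m.+1 0
| lcs_add m x y : lcs m.+1 x -> lcs m.+1 y -> lcs m.+1 (x + y)
| lcs_scale m (c : K) x : lcs m.+1 x -> lcs m.+1 (c *: x).

(* Spanning elements of  S S^Lie_{i_1} S ... S S^Lie_{i_m} S  with
   i_1 + ... + i_m - m = d. *)
Definition ncmon (d : nat) (x : S) : Prop :=
  exists (m : nat) (i : 'I_m -> nat) (a : 'I_m -> S) (r : 'I_m.+1 -> S),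
    [/\ forall j, (0 < i j)%N,
        forall j, lcs (i j) (a j),
        (\sum_(j < m) (i j - 1) = d)%N
      & x = r ord0 * \prod_(j < m) (a j * r (lift ord0 j))].

(* NC-filtration F^d S: the (additive, hence linear) span of these. *)
Inductive ncF (d : nat) : S -> Prop :=
| ncF_zero : ncF d 0
| ncF_mon x : ncmon d x -> ncF d x
| ncF_add x y : ncF d x -> ncF d y -> ncF d (x + y).

Inductive comm_ideal : S -> Prop :=
| ci_zero : comm_ideal 0
| ci_gen r a b s : comm_ideal (r * (a * b - b * a) * s)
| ci_add x y : comm_ideal x -> comm_ideal y -> comm_ideal (x + y).

Inductive subalg_gen (g : seq S) : S -> Prop :=
| sg_gen x : x \in g -> subalg_gen g x
| sg_one : subalg_gen g 1
| sg_add x y : subalg_gen g x -> subalg_gen g y -> subalg_gen g (x + y)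
| sg_scale (c : K) x : subalg_gen g x -> subalg_gen g (c *: x)
| sg_mul x y : subalg_gen g x -> subalg_gen g y -> subalg_gen g (x * y).

Definition fin_gen : Prop := exists g : seq S, forall x, subalg_gen g x.

Definition nc_nilpotent (d : nat) : Prop := forall x, ncF d.+1 x -> x = 0.

(* NC-complete: S -> lim_d S/F^d S is bijective (written with
   representatives in S of the elements of the quotients). *)
Definition nc_complete : Prop :=
  (forall x, (forall d, ncF d x) -> x = 0) /\
  (forall r : nat -> S, (forall d, ncF d (r d.+1 - r d)) ->
     exists x, forall d, ncF d (x - r d)).

Definition nilpotent_pred (I : S -> Prop) : Prop :=
  exists n : nat, forall a : 'I_n -> S, (forall j, I (a j)) ->
    \prod_(j < n) a j = 0.

Definition commutative_alg : Prop := forall x y : S, x * y = y * x.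

End NC.

Arguments ncF {K S}.
Arguments lcs {K S}.

(* Formal smoothness of Hom(S/F^{d+1}S, -) on N_d. A homomorphism
   S/F^{d+1}S -> L is the same as a homomorphism S -> L vanishing on
   F^{d+1} S. *)
Definition formally_smooth_mod (K : pzRingType) (S : algType K) (d : nat) : Prop :=
  forall (L' L : algType K) (p : L' -> L),
    nc_nilpotent L' d -> nc_nilpotent L d ->
    alg_hom p -> surj p ->
    nilpotent_pred (fun x : L' => p x = 0) ->
    forall f : S -> L, alg_hom f -> (forall x, ncF d.+1 x -> f x = 0) ->
    exists g : S -> L', [/\ alg_hom g, (forall x, ncF d.+1 x -> g x = 0)
                          & forall x, p (g x) = f x].

Definition quot_d_smooth (K : pzRingType) (S : algType K) (d : nat) : Prop :=
  (exists g : seq S, forall x, exists y, subalg_gen g y /\ ncF d.+1 (x - y))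
  /\ formally_smooth_mod S d.

Definition d_smooth (K : pzRingType) (S : algType K) (d : nat) : Prop :=
  [/\ fin_gen S, nc_nilpotent S d & formally_smooth_mod S d].

Definition nc_smooth (K : pzRingType) (S : algType K) : Prop :=
  nc_complete S /\ forall d, quot_d_smooth S d.

(* Smooth commutative algebra (finitely generated + formally smooth w.r.t.
   commutative algebras and nilpotent ideals, Grothendieck's definition). *)
Definition smooth_comm (K : pzRingType) (A : algType K) : Prop :=
  [/\ commutative_alg A, fin_gen A &
    forall (L' L : algType K) (p : L' -> L),
      commutative_alg L' -> commutative_alg L ->
      alg_hom p -> surj p ->
      nilpotent_pred (fun x : L' => p x = 0) ->
      forall f : A -> L, alg_hom f ->
      exists g : A -> L', alg_hom g /\ forall x, p (g x) = f x].

(* (R, phi) is a thickening of A: phi : R -> A is a surjective algebra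
   homomorphism with kernel the commutator ideal, i.e. it induces an
   isomorphism R_ab -> A. *)
Definition ab_iso (K : pzRingType) (S : algType K) (A : algType K) (phi : S -> A) : Prop :=
  [/\ alg_hom phi, surj phi & forall x, phi x = 0 <-> comm_ideal x].

(* Main.v *)
(** The thickenings are built as quotients [F / J d] of a free algebra [F] mapping
    onto [A].  Given [J d], let [S] be the ideal generated by the products of
    [J d] with the kernel of [F -> A], by the commutators [[F, J d]] and by the
    (d+2)-nd filtration step.  Lifting the identity of [F / J d] by d-smoothness
    produces an endomorphism [eps] of [F], equal to the identity modulo [J d],
    which modulo [S] retracts [J d] onto the (d+1)-st filtration step; then
    [J (d+1)] is the part of [J d] that [eps] sends into [S].  A map defined on
    [F / J (d+1)] is lifted generator by generator and then corrected by
    composing with [eps o eta], where [eta] is the reflection [2 - eps] of [eps]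
    modulo [S]: this composite sends [J (d+1)] into [S] and is the identity
    modulo [J (d+1)].

    The NC-smooth thickening is the inverse limit of the [F / J d]; its
    filtration steps are closed because each is the sum of finitely many
    continuous additive operators applied to the previous one.

    Two thickenings map to each other over [A] by smoothness, and an
    endomorphism over [A] is the identity on the associated graded algebra,
    hence bijective by completeness. *)
Require Import Defs.
From HB Require Import structures.
From mathcomp Require Import all_boot all_order all_algebra.
From mathcomp Require Import boolp.
From mathcomp Require Import complex reals.
Set Implicit Arguments.
Unset Strict Implicit.
Unset Printing Implicit Defensive.
Import GRing.Theory.
Local Open Scope ring_scope.

(** * Homomorphisms of algebras *)

Section Homs.
Variables (K : pzRingType) (S T : algType K).
Variables (f : S -> T) (hf : alg_hom f).

Lemma alg_homD x y : f (x + y) = f x + f y. Proof. by case: hf => h _ _ _; apply: h. Qed.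
Lemma alg_homZ c x : f (c *: x) = c *: f x. Proof. by case: hf => _ h _ _; apply: h. Qed.
Lemma alg_homM x y : f (x * y) = f x * f y. Proof. by case: hf => _ _ h _; apply: h. Qed.
Lemma alg_hom1 : f 1 = 1. Proof. by case: hf. Qed.
Lemma alg_hom0 : f 0 = 0. Proof. by rewrite -(scale0r 0) alg_homZ scale0r. Qed.
Lemma alg_homN x : f (- x) = - f x. Proof. by rewrite -scaleN1r alg_homZ scaleN1r. Qed.
Lemma alg_homB x y : f (x - y) = f x - f y. Proof. by rewrite alg_homD alg_homN. Qed.

Lemma alg_hom_sub_eq0 x y : f (x - y) = 0 -> f x = f y.
Proof. by move/eqP; rewrite alg_homB subr_eq0 => /eqP. Qed.

Lemma alg_hom_prod n (a : 'I_n -> S) : f (\prod_(j < n) a j) = \prod_(j < n) f (a j).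
Proof. exact: (big_morph f alg_homM alg_hom1). Qed.

End Homs.

Lemma alg_hom_comp (K : pzRingType) (S T U : algType K) (f : S -> T) (g : T -> U) : alg_hom f -> alg_hom g -> alg_hom (g \o f).
Proof.
move=> hf hg; split=> [x y|c x|x y|] /=.
- by rewrite (alg_homD hf) (alg_homD hg).
- by rewrite (alg_homZ hf) (alg_homZ hg).
- by rewrite (alg_homM hf) (alg_homM hg).
- by rewrite (alg_hom1 hf) (alg_hom1 hg).
Qed.

(** * Two-sided ideals and congruences modulo an ideal *)

Section Ideals.
Variables (K : pzRingType) (S : algType K).

Definition is_ideal (J : S -> Prop) : Prop :=
  [/\ J 0, forall x y, J x -> J y -> J (x + y),
      forall a x, J x -> J (a * x) & forall a x, J x -> J (x * a)].

Section OneIdeal.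
Variables (J : S -> Prop) (hJ : is_ideal J).

Lemma ideal0 : J 0. Proof. by case: hJ. Qed.
Lemma idealD x y : J x -> J y -> J (x + y). Proof. by case: hJ => _ h _ _; apply: h. Qed.
Lemma idealMl a x : J x -> J (a * x). Proof. by case: hJ => _ _ h _; apply: h. Qed.
Lemma idealMr a x : J x -> J (x * a). Proof. by case: hJ => _ _ _; apply. Qed.
Lemma idealZ c x : J x -> J (c *: x).
Proof. by move=> Jx; rewrite -[x]mul1r scalerAl; apply: idealMl. Qed.
Lemma idealN x : J x -> J (- x). Proof. by move=> Jx; rewrite -scaleN1r; apply: idealZ. Qed.
Lemma idealB x y : J x -> J y -> J (x - y).
Proof. by move=> Jx Jy; apply: idealD => //; apply: idealN. Qed.
Lemma ideal_subC x y : J (x - y) -> J (y - x).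
Proof. by move=> h; rewrite -opprB; apply: idealN. Qed.
Lemma ideal_sub_trans y x z : J (x - y) -> J (y - z) -> J (x - z).
Proof. by move=> h1 h2; rewrite -(subrKA y); apply: idealD. Qed.
Lemma ideal_sub_mem x y : J (x - y) -> J y -> J x.
Proof. by move=> h1 h2; rewrite -(subrK y x); apply: idealD. Qed.
Lemma ideal_subM x x' y y' : J (x - x') -> J (y - y') -> J (x * y - x' * y').
Proof.
move=> h1 h2; apply: (@ideal_sub_trans (x' * y)).
  by rewrite -mulrBl; apply: idealMr.
by rewrite -mulrBr; apply: idealMl.
Qed.
Lemma ideal_subD x x' y y' : J (x - x') -> J (y - y') -> J (x + y - (x' + y')).
Proof. by move=> h1 h2; rewrite opprD addrACA; apply: idealD. Qed.
Lemma ideal_subZ c x x' : J (x - x') -> J (c *: x - c *: x').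
Proof. by move=> h1; rewrite -scalerBr; apply: idealZ. Qed.

Lemma ideal_sum (I : finType) (F : I -> S) : (forall i, J (F i)) -> J (\sum_i F i).
Proof. by move=> h; elim/big_ind: _ => [|x y|i _ //]; [apply: ideal0 | apply: idealD]. Qed.

End OneIdeal.

Lemma ideal_sum_ideals (I J : S -> Prop) : is_ideal I -> is_ideal J ->
  is_ideal (fun x => exists2 y, I y & J (x - y)).
Proof.
move=> hI hJ; split.
- by exists 0; [apply: (ideal0 hI) | rewrite subr0; apply: (ideal0 hJ)].
- move=> x y [u Iu Ju] [v Iv Jv]; exists (u + v); first exact: idealD.
  exact: ideal_subD.
- move=> a x [u Iu Ju]; exists (a * u); first exact: idealMl.
  by rewrite -mulrBr; apply: idealMl.
- move=> a x [u Iu Ju]; exists (u * a); first exact: idealMr.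
  by rewrite -mulrBl; apply: idealMr.
Qed.

Inductive ideal_gen (P : S -> Prop) : S -> Prop :=
| ideal_gen_mem x : P x -> ideal_gen P x
| ideal_gen_zero : ideal_gen P 0
| ideal_gen_add x y : ideal_gen P x -> ideal_gen P y -> ideal_gen P (x + y)
| ideal_gen_mull a x : ideal_gen P x -> ideal_gen P (a * x)
| ideal_gen_mulr a x : ideal_gen P x -> ideal_gen P (x * a).

Lemma ideal_genP P : is_ideal (ideal_gen P).
Proof. by split; [constructor | constructor | constructor | constructor]. Qed.

Lemma ideal_gen_min (P J : S -> Prop) : is_ideal J -> (forall x, P x -> J x) ->
  forall x, ideal_gen P x -> J x.
Proof.
move=> hJ hP x; elim=> {x} //; first exact: ideal0.
- by move=> x y _ Jx _ Jy; apply: idealD.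
- by move=> a x _; apply: idealMl.
- by move=> a x _; apply: idealMr.
Qed.

End Ideals.

Lemma ideal_preim (K : pzRingType) (S T : algType K) (f : S -> T) (J : T -> Prop) :
  alg_hom f -> is_ideal J -> is_ideal (fun x => J (f x)).
Proof.
move=> hf hJ; split=> [|x y Jx Jy|a x Jx|a x Jx].
- by rewrite (alg_hom0 hf); apply: ideal0.
- by rewrite (alg_homD hf); apply: idealD.
- by rewrite (alg_homM hf); apply: idealMl.
- by rewrite (alg_homM hf); apply: idealMr.
Qed.

Lemma ideal_zero (K : pzRingType) (S : algType K) : is_ideal (fun x : S => x = 0).
Proof.
by split=> // [x y -> ->|a x ->|a x ->]; rewrite ?addr0 ?mulr0 ?mul0r.
Qed.

Lemma ideal_ker (K : pzRingType) (S T : algType K) (f : S -> T) :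
  alg_hom f -> is_ideal (fun x => f x = 0).
Proof. by move=> hf; exact: (ideal_preim hf (ideal_zero T)). Qed.

(** * Commutator calculus and the NC-filtration *)

Section NCFiltration.
Variables (K : pzRingType) (S : algType K).

Definition lie (a b : S) : S := a * b - b * a.

Lemma lieMr a b c : lie a (b * c) = lie a b * c + b * lie a c.
Proof. by rewrite /lie mulrBl mulrBr !mulrA addrA subrK. Qed.
Lemma lieMl a b c : lie (a * b) c = a * lie b c + lie a c * b.
Proof. by rewrite /lie mulrBl mulrBr !mulrA addrA subrK. Qed.
Lemma lieDr a b c : lie a (b + c) = lie a b + lie a c.
Proof. by rewrite /lie mulrDr mulrDl opprD addrACA. Qed.
Lemma lieDl a b c : lie (a + b) c = lie a c + lie b c.
Proof. by rewrite /lie mulrDr mulrDl opprD addrACA. Qed.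
Lemma lieNr a b : lie a (- b) = - lie a b.
Proof. by rewrite /lie mulrN mulNr opprB opprK addrC. Qed.
Lemma lieNl a b : lie (- a) b = - lie a b.
Proof. by rewrite /lie mulrN mulNr opprB opprK addrC. Qed.
Lemma lieZr c a b : lie a (c *: b) = c *: lie a b.
Proof. by rewrite /lie -scalerAr -scalerAl scalerBr. Qed.
Lemma lieZl c a b : lie (c *: a) b = c *: lie a b.
Proof. by rewrite /lie -scalerAr -scalerAl scalerBr. Qed.
Lemma lie0r a : lie a 0 = 0. Proof. by rewrite /lie mulr0 mul0r subr0. Qed.
Lemma lie_jacobi a b c : lie a (lie b c) = lie (lie a b) c + lie b (lie a c).
Proof.
rewrite [lie b c]/lie lieDr lieNr !lieMr opprD.
by rewrite [- _ - _]addrC addrACA.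
Qed.
Lemma lie0l a : lie 0 a = 0. Proof. by rewrite /lie mulr0 mul0r subr0. Qed.
Lemma lieC a b : lie a b = - lie b a. Proof. by rewrite /lie opprB. Qed.
Lemma lie1r a : lie a 1 = 0. Proof. by rewrite /lie mulr1 mul1r subrr. Qed.
Lemma lie1l a : lie 1 a = 0. Proof. by rewrite /lie mulr1 mul1r subrr. Qed.

(* The NC-filtration is the smallest family of additive subgroups that is
   everything in degree 0, is multiplicative, and is raised by one step by
   every commutator; see [ncF_ncfil]. *)
Inductive ncfil : nat -> S -> Prop :=
| ncfil_all x : ncfil 0 x
| ncfil_lie d a x : ncfil d x -> ncfil d.+1 (lie a x)
| ncfil_zero d : ncfil d 0
| ncfil_add d x y : ncfil d x -> ncfil d y -> ncfil d (x + y)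
| ncfil_mul a b x y : ncfil a x -> ncfil b y -> ncfil (a + b) (x * y).

Lemma ncfil_ideal d : is_ideal (ncfil d).
Proof.
split; [exact: ncfil_zero | exact: ncfil_add | |] => a x h.
  by rewrite -[d]add0n; apply: ncfil_mul => //; apply: ncfil_all.
by rewrite -[d]addn0; apply: ncfil_mul => //; apply: ncfil_all.
Qed.

Lemma ncfilS d x : ncfil d.+1 x -> ncfil d x.
Proof.
move De : d.+1 => e h; elim: h d De => {e x} // [d a x h _ e [->]|d e _|d x y _ IHx _ IHy e De|].
- apply: idealB; first exact: ncfil_ideal.
    by apply: idealMl => //; apply: ncfil_ideal.
  by apply: idealMr => //; apply: ncfil_ideal.
- exact: ncfil_zero.
- by apply: ncfil_add; [apply: IHx | apply: IHy].
(* A factor of positive degree is lowered: the second one when the first has degree 0, otherwise the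
   first. *)
- move=> [|a] b x y hx IHx hy IHy d.
    by rewrite add0n => De; apply: idealMl; [apply: ncfil_ideal | apply: IHy].
  by rewrite addSn => -[->]; apply: ncfil_mul => //; apply: IHx.
Qed.

Lemma ncfilW d e x : (d <= e)%N -> ncfil e x -> ncfil d x.
Proof.
move=> /subnK <-; elim: (e - d)%N => [//|k IH].
by rewrite addSn => /ncfilS.
Qed.

Lemma lcs_ncfil m x : lcs m.+1 x -> ncfil m x.
Proof.
move De : m.+1 => e h; elim: h m De => {e x}.
- by move=> x m [->]; apply: ncfil_all.
- by move=> m a b _ IH [//|k] [->]; apply: ncfil_lie; apply: IH.
- by move=> *; apply: ncfil_zero.
- by move=> m x y _ IHx _ IHy k De; apply: ncfil_add; [apply: IHx | apply: IHy].
- by move=> m c x _ IH k De; apply: idealZ; [apply: ncfil_ideal | apply: IH].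
Qed.

Lemma ncmon_ncfil d x : ncmon d x -> ncfil d x.
Proof.
case=> m [i [a [r [hi ha <- ->]]]]; apply: idealMl; first exact: ncfil_ideal.
elim: m i a r hi ha => [|m IH] i a r hi ha.
  by rewrite !big_ord0; apply: ncfil_all.
rewrite !big_ord_recl; apply: ncfil_mul.
  apply: idealMr; first exact: ncfil_ideal.
  by apply: lcs_ncfil; rewrite -addn1 subnK.
exact: (IH (fun j => i (lift ord0 j)) (fun j => a (lift ord0 j))
          (fun j => r (lift ord0 j))).
Qed.

(** An inductive form of [ncmon], free of indexed families: a factor from [lcs m.+1] contributes [m]
    to the degree. *)
Inductive ncword : nat -> S -> Prop :=
| ncword_nil r : ncword 0 r
| ncword_cons d m r a x :
    lcs m.+1 a -> ncword d x -> ncword (m + d) (r * a * x).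

Inductive ncspan (d : nat) : S -> Prop :=
| ncspan_zero : ncspan d 0
| ncspan_word x : ncword d x -> ncspan d x
| ncspan_add x y : ncspan d x -> ncspan d y -> ncspan d (x + y).

Lemma ncword_ncmon d x : ncword d x -> ncmon d x.
Proof.
elim=> {d x} [r|d m r a x ha _ [n [i [b [s [hi hb <- ->]]]]]].
  exists 0%N, (fun=> 1%N), (fun=> 0), (fun=> r).
  by split=> // [[]//||]; rewrite !big_ord0 ?mulr1.
exists n.+1, (fun j => if unlift ord0 j is Some k then i k else m.+1),
  (fun j => if unlift ord0 j is Some k then b k else a),
  (fun j => if unlift ord0 j is Some k then s k else r).
split.
- by move=> j; case: (unlift _ _).
- by move=> j; case: (unlift _ _).
- rewrite big_ord_recl unlift_none subn1 /=; congr (_ + _)%N.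
  by apply: eq_bigr => j _; rewrite liftK.
- rewrite unlift_none big_ord_recl unlift_none liftK !mulrA; congr (_ * _).
  by apply: eq_bigr => j _; rewrite !liftK.
Qed.

Lemma ncword_mull d r x : ncword d x -> ncword d (r * x).
Proof.
case=> {d x} [s|d m s a x ha hx]; first exact: ncword_nil.
by rewrite !mulrA; apply: ncword_cons.
Qed.

Lemma ncword_mul d e x y : ncword d x -> ncword e y -> ncword (d + e) (x * y).
Proof.
move=> h hy; elim: h => {d x} [r|d m r a x ha _ IH]; first exact: ncword_mull.
by rewrite -addnA -!mulrA mulrA; apply: ncword_cons.
Qed.

Lemma ncspan_mul d e x y : ncspan d x -> ncspan e y -> ncspan (d + e) (x * y).
Proof.
move=> hx hy; elim: hx => {x} [|x hx|x x' _ h _ h'].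
- by rewrite mul0r; apply: ncspan_zero.
- elim: hy => {y} [|y hy|y y' _ h _ h'].
  + by rewrite mulr0; apply: ncspan_zero.
  + by apply: ncspan_word; apply: ncword_mul.
  + by rewrite mulrDr; apply: ncspan_add.
- by rewrite mulrDl; apply: ncspan_add.
Qed.

Lemma ncspan_lcs m x : lcs m.+1 x -> ncspan m x.
Proof.
move=> h; apply: ncspan_word; rewrite -[x]mulr1 -[x]mul1r -[m]addn0.
by apply: ncword_cons => //; apply: ncword_nil.
Qed.

Lemma ncspan_all x : ncspan 0 x.
Proof. by apply: ncspan_word; apply: ncword_nil. Qed.

(** By the Leibniz rule the bracket with [c] falls on one factor of [r * a * x]: on [r] it creates a
    factor in [lcs 2], on [a] it raises the Lie depth by one, and on [x] the induction applies. *)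
Lemma ncspan_lie d c x : ncspan d x -> ncspan d.+1 (lie c x).
Proof.
elim=> {x} [|x|x y _ hx _ hy].
- by rewrite lie0r; apply: ncspan_zero.
- elim=> {d x} [r|d m r a x ha hx IH].
    by apply: ncspan_lcs; apply: lcs_comm; apply: lcs_one.
  have hs : ncspan d x by apply: ncspan_word.
  rewrite !lieMr mulrDl -addSn; apply: ncspan_add; first apply: ncspan_add.
  + apply: ncspan_mul hs; rewrite -add1n; apply: ncspan_mul; apply: ncspan_lcs => //.
    by apply: lcs_comm; apply: lcs_one.
  + apply: ncspan_mul hs; rewrite -[m.+1]add0n; apply: ncspan_mul (ncspan_all _) _.
    by apply: ncspan_lcs; apply: lcs_comm.
  + rewrite addSnnS; apply: ncspan_mul IH; rewrite -[m]add0n.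
    by apply: ncspan_mul (ncspan_all _) _; apply: ncspan_lcs.
- by rewrite lieDr; apply: ncspan_add.
Qed.

Lemma ncF_ncfil d x : ncF d x <-> ncfil d x.
Proof.
split; first by elim=> {x} [|x /ncmon_ncfil //|x y _ hx _ hy];
  [apply: ncfil_zero | apply: ncfil_add].
have sF : ncspan d x -> ncF d x.
  elim=> {x} [|x h|x y _ hx _ hy]; first exact: ncF_zero.
    by apply: ncF_mon; apply: ncword_ncmon.
  exact: ncF_add.
move=> h; apply: sF; elim: h => {d x} *.
- exact: ncspan_all.
- exact: ncspan_lie.
- exact: ncspan_zero.
- exact: ncspan_add.
- exact: ncspan_mul.
Qed.

Lemma comm_ideal_ideal : is_ideal (@comm_ideal K S).
Proof.
split; [exact: ci_zero | exact: ci_add | |] => c x; elim=> {x}.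
- by rewrite mulr0; apply: ci_zero.
- by move=> r a b s; rewrite !mulrA; apply: ci_gen.
- by move=> x y _ hx _ hy; rewrite mulrDr; apply: ci_add.
- by rewrite mul0r; apply: ci_zero.
- by move=> r a b s; rewrite -(mulrA _ s); apply: ci_gen.
- by move=> x y _ hx _ hy; rewrite mulrDl; apply: ci_add.
Qed.

Lemma ncfil1_comm_ideal x : ncfil 1 x <-> comm_ideal x.
Proof.
split; last first.
  elim=> {x} [|r a b s|x y _ hx _ hy]; [exact: ncfil_zero| |exact: ncfil_add].
  apply: idealMr; first exact: ncfil_ideal.
  apply: idealMl; first exact: ncfil_ideal.
  by apply: ncfil_lie; apply: ncfil_all.
suff h e y : ncfil e y -> (0 < e)%N -> comm_ideal y by move=> /h; apply.
elim=> {e y} //.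
- move=> d a y _ _ _.
  by rewrite -[lie a y]mulr1 -[lie a y]mul1r; exact: (ci_gen 1 a y 1).
- by move=> d _; apply: ci_zero.
- by move=> d y z _ hy _ hz d0; apply: ci_add; [apply: hy | apply: hz].
- move=> [|a] b y z _ hy _ hz.
    by rewrite add0n => /hz h; apply: idealMl => //; apply: comm_ideal_ideal.
  by move=> _; apply: idealMr; [apply: comm_ideal_ideal | apply: hy].
Qed.

Lemma nc_nilpotentP d : nc_nilpotent S d <-> forall x, ncfil d.+1 x -> x = 0.
Proof. by split=> h x hx; apply: h; apply/ncF_ncfil. Qed.

Lemma ncfil1_eq0 : commutative_alg S -> forall x, ncfil 1 x -> x = 0.
Proof.
move=> comS x /ncfil1_comm_ideal; elim=> {x} // [r a b s|x y _ -> _ ->].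
  by rewrite (comS a b) subrr mulr0 mul0r.
by rewrite addr0.
Qed.

Lemma commutative_nc_nilpotent d : commutative_alg S -> nc_nilpotent S d.
Proof.
move=> comS; apply/nc_nilpotentP => x hx.
by apply: (ncfil1_eq0 comS); apply: ncfilW hx.
Qed.

Lemma nc_nilpotent0_commutative : nc_nilpotent S 0 -> commutative_alg S.
Proof.
move/nc_nilpotentP => h x y; apply/eqP; rewrite -subr_eq0; apply/eqP; apply: h.
by apply: ncfil_lie; apply: ncfil_all.
Qed.

Lemma ncfil_prod d n (a : 'I_n -> S) :
  (forall j, ncfil d (a j)) -> ncfil (n * d) (\prod_(j < n) a j).
Proof.
elim: n a => [|n IH] a ha; first by rewrite big_ord0; apply: ncfil_all.
by rewrite big_ord_recl mulSn; apply: ncfil_mul => //; apply: IH => j; apply: ha.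
Qed.

End NCFiltration.

(** * Functoriality of the NC-filtration *)

Section NCFunctoriality.
Variables (K : pzRingType) (S T : algType K).

Lemma alg_hom_lie (f : S -> T) : alg_hom f -> forall a b, f (lie a b) = lie (f a) (f b).
Proof. by move=> hf a b; rewrite /lie (alg_homB hf) !(alg_homM hf). Qed.

Lemma ncfil_hom (f : S -> T) : alg_hom f -> forall d x, ncfil d x -> ncfil d (f x).
Proof.
move=> hf d x; elim=> {d x}.
- by move=> x; apply: ncfil_all.
- by move=> d a x _ h; rewrite (alg_hom_lie hf); apply: ncfil_lie.
- by move=> d; rewrite (alg_hom0 hf); apply: ncfil_zero.
- by move=> d x y _ hx _ hy; rewrite (alg_homD hf); apply: ncfil_add.
- by move=> a b x y _ hx _ hy; rewrite (alg_homM hf); apply: ncfil_mul.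
Qed.

Lemma ncfil_hom_eq0 (f : S -> T) d : alg_hom f -> nc_nilpotent T d ->
  forall x, ncfil d.+1 x -> f x = 0.
Proof. by move=> hf /nc_nilpotentP hT x hx; apply: hT; apply: ncfil_hom. Qed.

Lemma ncfil_surj (f : S -> T) : alg_hom f -> surj f ->
  forall d y, ncfil d y -> exists2 x, ncfil d x & f x = y.
Proof.
move=> hf sf d y; elim=> {d y}.
- by move=> y; have [x <-] := sf y; exists x => //; apply: ncfil_all.
- move=> d b _ _ [x hx <-]; have [a <-] := sf b.
  by exists (lie a x); [apply: ncfil_lie | apply: alg_hom_lie].
- by move=> d; exists 0; [apply: ncfil_zero | apply: alg_hom0].
- move=> d _ _ _ [x hx <-] _ [y hy <-].
  by exists (x + y); [apply: ncfil_add | apply: alg_homD].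
- move=> a b _ _ _ [x hx <-] _ [y hy <-].
  by exists (x * y); [apply: ncfil_mul | apply: alg_homM].
Qed.

End NCFunctoriality.

(** * Perturbation of homomorphisms along a filtration *)

Section NCStability.
Variables (K : pzRingType) (S T : algType K) (B : nat -> T -> Prop).
Hypothesis B_ideal : forall k, is_ideal (B k).
Hypothesis lieB : forall k a x, B k x -> B k.+1 (lie a x).
Hypothesis mulBF : forall a b x y, B a x -> ncfil b y -> B (a + b) (x * y).
Hypothesis mulFB : forall a b x y, ncfil a x -> B b y -> B (a + b) (x * y).

(** Bracketing with an element of step [b] gains [b + 1], more than the single step of [lieB]: the
    Jacobi identity treats a bracket in [x], the Leibniz rule a product. *)
Lemma lie_ncfil_stable a b c x : B a c -> ncfil b x -> B (a + b).+1 (lie x c).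
Proof.
move=> hc hx; elim: hx a c hc => {b x}.
- by move=> x a c hc; rewrite addn0; apply: lieB.
- move=> d y x hx IH a c hc.
  have -> : lie (lie y x) c = lie y (lie x c) - lie x (lie y c).
    by rewrite lie_jacobi addrK.
  rewrite addnS; apply: (idealB (B_ideal _)); first by apply: lieB; apply: IH.
  by rewrite -addSn; apply: IH; apply: lieB.
- move=> d a c hc; rewrite lie0l.
  exact: (ideal0 (B_ideal _)).
- move=> d x y _ hx _ hy a c hc; rewrite lieDl.
  by apply: (idealD (B_ideal _)); [apply: hx | apply: hy].
- move=> d e x y hx IHx hy IHy a c hc; rewrite lieMl.
  apply: (idealD (B_ideal _)).
    by rewrite addnCA -addnS; apply: mulFB => //; apply: IHy.
  by rewrite addnA -addSn; apply: mulBF => //; apply: IHx.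
Qed.

(* The filtration is built from commutators and products, so perturbing one
   argument of a k-fold expression by [B 0] moves its value by [B k]. *)
Lemma ncfil_congr (u v : S -> T) : alg_hom u -> alg_hom v ->
  (forall x, B 0 (u x - v x)) -> forall k x, ncfil k x -> B k (u x - v x).
Proof.
move=> hu hv h0 k x; elim=> {k x} //.
- move=> d a x hx IH; rewrite (alg_hom_lie hu) (alg_hom_lie hv).
  have -> : lie (u a) (u x) - lie (v a) (v x) =
     lie (u a) (u x - v x) - lie (v x) (u a - v a).
    by rewrite [lie (v x) _]lieC opprK lieDr lieDl lieNr lieNl addrA subrK.
  apply: (idealB (B_ideal _)); first exact: lieB.
  by rewrite -[d.+1]/(0 + d).+1; apply: lie_ncfil_stable => //; apply: ncfil_hom.
- by move=> d; rewrite (alg_hom0 hu) (alg_hom0 hv) subrr; apply: (ideal0 (B_ideal _)).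
- move=> d x y _ hx _ hy; rewrite (alg_homD hu) (alg_homD hv).
  exact: (ideal_subD (B_ideal _)).
- move=> a b x y hx IHx hy IHy; rewrite (alg_homM hu) (alg_homM hv).
  rewrite -(subrKA (v x * u y)) -mulrBl -mulrBr; apply: (idealD (B_ideal _)).
    by apply: mulBF => //; apply: ncfil_hom.
  by apply: mulFB => //; apply: ncfil_hom.
Qed.

End NCStability.

(** * Quotient algebras *)

Section SetoidQuotient.
Variables (K : pzRingType) (T : Type) (e : T -> T -> Prop).
Variables (z o : T) (opp : T -> T) (add mul : T -> T -> T) (sc : K -> T -> T).
Hypothesis e_refl : forall x, e x x.
Hypothesis e_sym : forall x y, e x y -> e y x.
Hypothesis e_trans : forall y x z, e x y -> e y z -> e x z.
Hypothesis e_opp : forall x y, e x y -> e (opp x) (opp y).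
Hypothesis e_add : forall x x' y y', e x x' -> e y y' -> e (add x y) (add x' y').
Hypothesis e_mul : forall x x' y y', e x x' -> e y y' -> e (mul x y) (mul x' y').
Hypothesis e_sc : forall c x y, e x y -> e (sc c x) (sc c y).
Hypothesis addA_ : forall x y w, e (add x (add y w)) (add (add x y) w).
Hypothesis addC_ : forall x y, e (add x y) (add y x).
Hypothesis add0_ : forall x, e (add z x) x.
Hypothesis addN_ : forall x, e (add (opp x) x) z.
Hypothesis mulA_ : forall x y w, e (mul x (mul y w)) (mul (mul x y) w).
Hypothesis mul1l_ : forall x, e (mul o x) x.
Hypothesis mul1r_ : forall x, e (mul x o) x.
Hypothesis mulDl_ : forall x y w, e (mul (add x y) w) (add (mul x w) (mul y w)).
Hypothesis mulDr_ : forall x y w, e (mul w (add x y)) (add (mul w x) (mul w y)).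
Hypothesis scA_ : forall a b x, e (sc a (sc b x)) (sc (a * b) x).
Hypothesis sc1_ : forall x, e (sc 1 x) x.
Hypothesis scDr_ : forall a x y, e (sc a (add x y)) (add (sc a x) (sc a y)).
Hypothesis scDl_ : forall x a b, e (sc (a + b) x) (add (sc a x) (sc b x)).
Hypothesis scAl_ : forall a x y, e (sc a (mul x y)) (mul (sc a x) y).
Hypothesis scAr_ : forall a x y, e (sc a (mul x y)) (mul x (sc a y)).
Hypothesis neq10 : ~ e o z.

(** The classes of [e] as predicates; extensionality turns equivalence into equality of classes, and
    representatives are chosen classically. *)
Definition setoid_quot : Type := {P : T -> Prop | exists t, P = e t}.

Definition sqpi (t : T) : setoid_quot := exist _ (e t) (ex_intro _ t erefl).
Definition sqrepr (q : setoid_quot) : T := projT1 (cid (proj2_sig q)).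

Lemma sqpiP s t : sqpi s = sqpi t <-> e s t.
Proof.
split=> [[->]//|est]; apply: eq_exist; apply/funext => w; apply/propext.
by split; apply: e_trans => //; apply: e_sym.
Qed.

Lemma sqreprK q : sqpi (sqrepr q) = q.
Proof. by case: q => P hP; apply: eq_exist; rewrite /sqrepr; case: cid. Qed.

Lemma sqpi_repr t : e (sqrepr (sqpi t)) t.
Proof. by apply/sqpiP; rewrite sqreprK. Qed.

Definition sqadd q r := sqpi (add (sqrepr q) (sqrepr r)).
Definition sqmul q r := sqpi (mul (sqrepr q) (sqrepr r)).
Definition sqopp q := sqpi (opp (sqrepr q)).
Definition sqsc c q := sqpi (sc c (sqrepr q)).

Lemma sqaddE s t : sqadd (sqpi s) (sqpi t) = sqpi (add s t).
Proof. by apply/sqpiP; apply: e_add; apply: sqpi_repr. Qed.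
Lemma sqmulE s t : sqmul (sqpi s) (sqpi t) = sqpi (mul s t).
Proof. by apply/sqpiP; apply: e_mul; apply: sqpi_repr. Qed.
Lemma sqoppE s : sqopp (sqpi s) = sqpi (opp s).
Proof. by apply/sqpiP; apply: e_opp; apply: sqpi_repr. Qed.
Lemma sqscE c s : sqsc c (sqpi s) = sqpi (sc c s).
Proof. by apply/sqpiP; apply: e_sc; apply: sqpi_repr. Qed.

Let sqE := (sqaddE, sqmulE, sqoppE, sqscE).

HB.instance Definition _ := gen_eqMixin setoid_quot.
HB.instance Definition _ := gen_choiceMixin setoid_quot.

Lemma sqaddA : associative sqadd.
Proof.
move=> x y w; rewrite -(sqreprK x) -(sqreprK y) -(sqreprK w) !sqE.
exact/sqpiP.
Qed.
Lemma sqaddC : commutative sqadd.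
Proof. by move=> x y; rewrite -(sqreprK x) -(sqreprK y) !sqE; exact/sqpiP. Qed.
Lemma sqadd0 : left_id (sqpi z) sqadd.
Proof. by move=> x; rewrite -(sqreprK x) !sqE; exact/sqpiP. Qed.
Lemma sqaddN : left_inverse (sqpi z) sqopp sqadd.
Proof. by move=> x; rewrite -(sqreprK x) !sqE; exact/sqpiP. Qed.

HB.instance Definition _ :=
  GRing.isZmodule.Build setoid_quot sqaddA sqaddC sqadd0 sqaddN.

Lemma sqmulA : associative sqmul.
Proof.
move=> x y w; rewrite -(sqreprK x) -(sqreprK y) -(sqreprK w) !sqE.
exact/sqpiP.
Qed.
Lemma sqmul1l : left_id (sqpi o) sqmul.
Proof. by move=> x; rewrite -(sqreprK x) !sqE; exact/sqpiP. Qed.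
Lemma sqmul1r : right_id (sqpi o) sqmul.
Proof. by move=> x; rewrite -(sqreprK x) !sqE; exact/sqpiP. Qed.
Lemma sqmulDl : left_distributive sqmul sqadd.
Proof.
move=> x y w; rewrite -(sqreprK x) -(sqreprK y) -(sqreprK w) !sqE.
exact/sqpiP.
Qed.
Lemma sqmulDr : right_distributive sqmul sqadd.
Proof.
move=> x y w; rewrite -(sqreprK x) -(sqreprK y) -(sqreprK w) !sqE.
exact/sqpiP.
Qed.
Lemma sq1_neq0 : sqpi o != sqpi z.
Proof. by apply/eqP => /sqpiP. Qed.

HB.instance Definition _ := GRing.Zmodule_isNzRing.Build setoid_quot
  sqmulA sqmul1l sqmul1r sqmulDl sqmulDr sq1_neq0.

Lemma sqscA a b x : sqsc a (sqsc b x) = sqsc (a * b) x.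
Proof. by rewrite -(sqreprK x) !sqE; exact/sqpiP. Qed.
Lemma sqsc1 : left_id 1 sqsc.
Proof. by move=> x; rewrite -(sqreprK x) !sqE; exact/sqpiP. Qed.
Lemma sqscDr : right_distributive sqsc sqadd.
Proof. by move=> a x y; rewrite -(sqreprK x) -(sqreprK y) !sqE; exact/sqpiP. Qed.
Lemma sqscDl x : {morph sqsc^~ x : a b / a + b >-> sqadd a b}.
Proof. by move=> a b /=; rewrite -(sqreprK x) !sqE; exact/sqpiP. Qed.

HB.instance Definition _ := GRing.Zmodule_isLmodule.Build K setoid_quot
  sqscA sqsc1 sqscDr sqscDl.

Lemma sqscAl a x y : sqsc a (sqmul x y) = sqmul (sqsc a x) y.
Proof. by rewrite -(sqreprK x) -(sqreprK y) !sqE; exact/sqpiP. Qed.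
Lemma sqscAr a x y : sqsc a (sqmul x y) = sqmul x (sqsc a y).
Proof. by rewrite -(sqreprK x) -(sqreprK y) !sqE; exact/sqpiP. Qed.

HB.instance Definition _ := GRing.Lmodule_isLalgebra.Build K setoid_quot sqscAl.
HB.instance Definition _ := GRing.Lalgebra_isAlgebra.Build K setoid_quot sqscAr.

(** The laws are assumed only up to [e] on a bare type, so that one construction yields quotients by
    ideals, free algebras from terms, and inverse limits from Cauchy sequences. The assumption
    [neq10] reflects that algebras here are nonzero. *)
Lemma setoid_alg_quotient : exists (Q : algType K) (p : T -> Q),
  [/\ surj p, forall s t, p s = p t <-> e s t,
      forall s t, p (add s t) = p s + p t,
      forall c s, p (sc c s) = c *: p s &
      (forall s t, p (mul s t) = p s * p t) /\ p o = 1].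
Proof.
exists setoid_quot, sqpi; split; last split=> //.
- by move=> q; exists (sqrepr q); apply: sqreprK.
- exact: sqpiP.
- by move=> s t; rewrite -sqaddE.
- by move=> c s; rewrite -sqscE.
- by move=> s t; rewrite -sqmulE.
Qed.

End SetoidQuotient.

Lemma ideal_quotient (K : pzRingType) (S : algType K) (J : S -> Prop) :
  is_ideal J -> ~ J 1 ->
  exists (Q : algType K) (p : S -> Q),
    [/\ alg_hom p, surj p & forall x, p x = 0 <-> J x].
Proof.
move=> hJ J1.
have eJ x y : x = y -> J (x - y) by move=> ->; rewrite subrr; apply: ideal0.
have [|||||||||||||||||||||||Q [p [sp pE pD pZ [pM p1]]]] := @setoid_alg_quotient K S
  (fun x y => J (x - y)) 0 1 (@GRing.opp S) +%R *%R *:%R.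
- by move=> x; apply: eJ.
- by move=> x y; apply: ideal_subC.
- by move=> y x w; apply: ideal_sub_trans.
- by move=> x y h; rewrite -opprD; apply: idealN.
- by move=> *; apply: ideal_subD.
- by move=> *; apply: ideal_subM.
- by move=> *; apply: ideal_subZ.
- by move=> *; apply: eJ; rewrite addrA.
- by move=> *; apply: eJ; rewrite addrC.
- by move=> *; apply: eJ; rewrite add0r.
- by move=> *; apply: eJ; rewrite addNr.
- by move=> *; apply: eJ; rewrite mulrA.
- by move=> *; apply: eJ; rewrite mul1r.
- by move=> *; apply: eJ; rewrite mulr1.
- by move=> *; apply: eJ; rewrite mulrDl.
- by move=> *; apply: eJ; rewrite mulrDr.
- by move=> *; apply: eJ; rewrite scalerA.
- by move=> *; apply: eJ; rewrite scale1r.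
- by move=> *; apply: eJ; rewrite scalerDr.
- by move=> *; apply: eJ; rewrite scalerDl.
- by move=> *; apply: eJ; rewrite scalerAl.
- by move=> *; apply: eJ; rewrite scalerAr.
- by rewrite subr0.
have hp : alg_hom p by split.
exists Q, p; split=> // x; rewrite -(alg_hom0 hp); split=> [/pE|h].
  by rewrite subr0.
by apply/pE; rewrite subr0.
Qed.

Lemma factor_hom (K : pzRingType) (S Q L : algType K) (p : S -> Q) (f : S -> L) :
  alg_hom p -> surj p -> alg_hom f -> (forall x, p x = 0 -> f x = 0) ->
  exists2 g : Q -> L, alg_hom g & forall x, g (p x) = f x.
Proof.
move=> hp sp hf h; have [r rK] := choice sp.
have fr x : f (r (p x)) = f x.
  apply/eqP; rewrite -subr_eq0 -(alg_homB hf); apply/eqP; apply: h.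
  by rewrite (alg_homB hp) rK subrr.
exists (f \o r) => [|x]; last exact: fr.
split=> [x y|c x|x y|] /=.
- by rewrite -{1}(rK x) -{1}(rK y) -(alg_homD hp) fr (alg_homD hf).
- by rewrite -{1}(rK x) -(alg_homZ hp) fr (alg_homZ hf).
- by rewrite -{1}(rK x) -{1}(rK y) -(alg_homM hp) fr (alg_homM hf).
- by rewrite -(alg_hom1 hp) fr (alg_hom1 hf).
Qed.

(** * Free algebras and homomorphisms determined on generators *)

Inductive alg_term (K : Type) (n : nat) : Type :=
| TVar of 'I_n
| TOne
| TAdd of alg_term K n & alg_term K n
| TMul of alg_term K n & alg_term K n
| TScale of K & alg_term K n.

Arguments TVar {K n}.
Arguments TOne {K n}.

Fixpoint term_eval (K : pzRingType) n (L : algType K) (v : 'I_n -> L) (t : alg_term K n) : L :=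
  match t with
  | TVar i => v i
  | TOne => 1
  | TAdd s t => term_eval v s + term_eval v t
  | TMul s t => term_eval v s * term_eval v t
  | TScale c t => c *: term_eval v t
  end.

Section FreeAlgebra.
Variables (K : pzRingType) (n : nat).

Definition is_free (F : algType K) (x : 'I_n -> F) : Prop :=
  (forall f, subalg_gen (codom x) f) /\
  forall (L : algType K) (v : 'I_n -> L),
    exists2 g : F -> L, alg_hom g & forall i, g (x i) = v i.

(* Terms are identified when they agree under every evaluation; a witness
   algebra [A] is only needed to see that 0 and 1 stay different. *)
Lemma free_alg_exists (A : algType K) :
  exists (F : algType K) (x : 'I_n -> F), is_free x.
Proof.
pose E (s t : alg_term K n) :=
  forall (L : algType K) (v : 'I_n -> L), term_eval v s = term_eval v t.
(* Zero is represented by the term [TScale 0 TOne] and the opposite by scaling with -1. *)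
have [|||||||||||||||||||||||F [p [sp pE pD pZ [pM p1]]]] := @setoid_alg_quotient K _
  E (TScale 0 TOne) TOne (@TScale K n (-1)) (@TAdd K n) (@TMul K n) (@TScale K n).
- by [].
- by move=> x y h L v; rewrite h.
- by move=> y x z h1 h2 L v; rewrite h1.
- by move=> x y h L v /=; rewrite h.
- by move=> x x' y y' h h' L v /=; rewrite h h'.
- by move=> x x' y y' h h' L v /=; rewrite h h'.
- by move=> c x y h L v /=; rewrite h.
- by move=> x y w L v /=; rewrite addrA.
- by move=> x y L v /=; rewrite addrC.
- by move=> x L v /=; rewrite scale0r add0r.
- by move=> x L v /=; rewrite scaleN1r scale0r addNr.
- by move=> x y w L v /=; rewrite mulrA.
- by move=> x L v /=; rewrite mul1r.
- by move=> x L v /=; rewrite mulr1.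
- by move=> x y w L v /=; rewrite mulrDl.
- by move=> x y w L v /=; rewrite mulrDr.
- by move=> a b x L v /=; rewrite scalerA.
- by move=> x L v /=; rewrite scale1r.
- by move=> a x y L v /=; rewrite scalerDr.
- by move=> x a b L v /=; rewrite scalerDl.
- by move=> a x y L v /=; rewrite scalerAl.
- by move=> a x y L v /=; rewrite scalerAr.
- by move=> /(_ A (fun=> 0)) /eqP /=; rewrite scale0r oner_eq0.
exists F, (fun i => p (TVar i)); split=> [f|L v].
  have [t <-] := sp f; elim: t => [i||s IHs t IHt|s IHs t IHt|c t IHt].
  - by apply: sg_gen; apply: (codom_f (fun i => p (TVar i))).
  - by rewrite p1; apply: sg_one.
  - by rewrite pD; apply: sg_add.
  - by rewrite pM; apply: sg_mul.
  - by rewrite pZ; apply: sg_scale.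
have [r rK] := choice sp.
have rp t : term_eval v (r (p t)) = term_eval v t.
  by have /pE := rK (p t); apply.
exists (fun f => term_eval v (r f)) => [|i]; last by rewrite rp.
split=> [x y|c x|x y|].
- by rewrite -{1}(rK x) -{1}(rK y) -pD rp.
- by rewrite -{1}(rK x) -pZ rp.
- by rewrite -{1}(rK x) -{1}(rK y) -pM rp.
- by rewrite -p1 rp.
Qed.

Variables (F : algType K) (x : 'I_n -> F).
Hypothesis genF : forall f, subalg_gen (codom x) f.

Lemma hom_congr_gens (L : algType K) (J : L -> Prop) (u v : F -> L) : is_ideal J ->
  alg_hom u -> alg_hom v -> (forall i, J (u (x i) - v (x i))) ->
  forall f, J (u f - v f).
Proof.
move=> hJ hu hv h f; elim: (genF f) => {f} [f /codomP[i ->]//||a b _ ha _ hb|c a _ ha|a b _ ha _ hb].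
- by rewrite (alg_hom1 hu) (alg_hom1 hv) subrr; apply: ideal0.
- by rewrite (alg_homD hu) (alg_homD hv); apply: ideal_subD.
- by rewrite (alg_homZ hu) (alg_homZ hv); apply: ideal_subZ.
- by rewrite (alg_homM hu) (alg_homM hv); apply: ideal_subM.
Qed.

Lemma hom_eq_gens (L : algType K) (u v : F -> L) :
  alg_hom u -> alg_hom v -> (forall i, u (x i) = v (x i)) -> u =1 v.
Proof.
move=> hu hv h f; apply/eqP; rewrite -subr_eq0; apply/eqP.
apply: (hom_congr_gens (ideal_zero L) hu hv) => i.
by rewrite h subrr.
Qed.

End FreeAlgebra.

Lemma alg_hom_id (K : pzRingType) (S : algType K) : alg_hom (@id S).
Proof. by []. Qed.

Lemma nc_nilpotent_quotient (K : pzRingType) (S Q : algType K) (q : S -> Q) d :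
  alg_hom q -> surj q -> (forall x, ncfil d.+1 x -> q x = 0) -> nc_nilpotent Q d.
Proof.
move=> hq sq hqd; apply/nc_nilpotentP => y /(ncfil_surj hq sq) [x hx <-].
exact: hqd.
Qed.

Lemma ncfil_quotient (K : pzRingType) (S : algType K) d e :
  nc_nilpotent S e ->
  exists (Q : algType K) (q : S -> Q),
    [/\ alg_hom q, surj q, forall x, q x = 0 <-> ncfil d.+1 x & nc_nilpotent Q d].
Proof.
move=> /nc_nilpotentP hS.
have [|Q [q [hq sq kq]]] := @ideal_quotient K S (ncfil d.+1) (ncfil_ideal S d.+1).
  (* If 1 lay in step [d.+1], its power of exponent [e.+1] would lie in step [e.+1], which is
     zero. *)
  move=> h; have := @ncfil_prod K S d.+1 e.+1 (fun=> 1) (fun=> h).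
  move/(ncfilW (leq_pmulr _ (ltn0Sn _))) => /hS /eqP.
  by rewrite big1 // oner_eq0.
exists Q, q; split=> //.
by apply: (nc_nilpotent_quotient hq sq) => x; apply: (kq x).2.
Qed.

Lemma subalg_gen_hom (K : pzRingType) (S T : algType K) (f : S -> T) (g : seq S) y :
  alg_hom f -> subalg_gen g y -> subalg_gen (map f g) (f y).
Proof.
move=> hf; elim=> {y} [y hy||y z _ hy _ hz|c y _ hy|y z _ hy _ hz].
- by apply: sg_gen; apply: map_f.
- by rewrite (alg_hom1 hf); apply: sg_one.
- by rewrite (alg_homD hf); apply: sg_add.
- by rewrite (alg_homZ hf); apply: sg_scale.
- by rewrite (alg_homM hf); apply: sg_mul.
Qed.

(** * Ideals of the free algebra that define thickenings *)

Section Thickening.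
Variables (K : pzRingType) (A : algType K) (n : nat).
Variables (F : algType K) (x : 'I_n -> F) (pi : F -> A).
Hypotheses (comA : commutative_alg A) (hpi : alg_hom pi).
Hypothesis freeF : is_free x.

Let genF : forall f, subalg_gen (codom x) f := freeF.1.

(** Formal smoothness of [F / J], with homomorphisms out of the quotient replaced by homomorphisms
    out of [F] that kill [J]; lifts can then be prescribed on the free generators. *)
Definition lifts_mod (d : nat) (J : F -> Prop) : Prop :=
  forall (L' L : algType K) (p : L' -> L),
    nc_nilpotent L' d -> nc_nilpotent L d ->
    alg_hom p -> surj p ->
    nilpotent_pred (fun y : L' => p y = 0) ->
    forall g : F -> L, alg_hom g -> (forall f, J f -> g f = 0) ->
    exists g' : F -> L', [/\ alg_hom g', forall f, J f -> g' f = 0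
                           & forall f, p (g' f) = g f].

(* [F / J] is a d-smooth thickening of [A], via [pi]. *)
Definition thickening_ideal (d : nat) (J : F -> Prop) : Prop :=
  [/\ is_ideal J, forall f, ncfil d.+1 f -> J f, forall f, J f -> pi f = 0,
      forall f, pi f = 0 -> exists2 u, ncfil 1 u & J (f - u) & lifts_mod d J].

Lemma ncfil1_ker f : ncfil 1 f -> pi f = 0.
Proof. by move=> h; apply: (ncfil1_eq0 comA); apply: ncfil_hom. Qed.

(** Algebras NC-nilpotent of degree 0 are the commutative ones, so smoothness of [A] among
    commutative algebras is its 0-smoothness. *)
Lemma thickening_ideal0 : surj pi -> smooth_comm A ->
  thickening_ideal 0 (fun f => pi f = 0).
Proof.
move=> spi [_ _ smA]; split=> //; first exact: (ideal_ker hpi).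
- exact: ncfil1_ker.
- move=> f hf; exists 0; first exact: ncfil_zero.
  by rewrite subr0.
move=> L' L p /nc_nilpotent0_commutative cL' /nc_nilpotent0_commutative cL hp sp np g hg gJ.
have [g1 hg1 g1E] := factor_hom hpi spi hg gJ.
have [g2 [hg2 g2E]] := smA _ _ _ cL' cL hp sp np g1 hg1.
exists (g2 \o pi); split=> [|f /= -> |f /=]; first exact: alg_hom_comp.
  exact: alg_hom0.
by rewrite g2E g1E.
Qed.

(** * Passage from degree d to degree d + 1 *)

Section Step.
Variables (d : nat) (J : F -> Prop).
Hypothesis hJ : thickening_ideal d J.

Let idJ : is_ideal J. Proof. by case: hJ. Qed.
Let ncJ f : ncfil d.+1 f -> J f. Proof. by case: hJ => _ h _ _ _; apply: h. Qed.
Let Jker f : J f -> pi f = 0. Proof. by case: hJ => _ _ h _ _; apply: h. Qed.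
Let kerJ f : pi f = 0 -> exists2 u, ncfil 1 u & J (f - u).
Proof. by case: hJ => _ _ _ h _; apply: h. Qed.

(** Its generators vanish under every homomorphism into an algebra NC-nilpotent of degree [d.+1]
    that carries [J] into step [d.+1] and the kernel of [pi] into step 1. *)
Definition small_ideal : F -> Prop := ideal_gen (fun f =>
  [\/ exists a b, [/\ J a, pi b = 0 & f = a * b],
      exists a b, [/\ pi a = 0, J b & f = a * b],
      exists a b, J b /\ f = lie a b | ncfil d.+2 f]).

Lemma small_idealP : is_ideal small_ideal. Proof. exact: ideal_genP. Qed.
Let idS := small_idealP.

Lemma small_mulr a b : J a -> pi b = 0 -> small_ideal (a * b).
Proof. by move=> ha hb; apply: ideal_gen_mem; apply: Or41; exists a, b. Qed.
Lemma small_mull a b : pi a = 0 -> J b -> small_ideal (a * b).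
Proof. by move=> ha hb; apply: ideal_gen_mem; apply: Or42; exists a, b. Qed.
Lemma small_lie a b : J b -> small_ideal (lie a b).
Proof. by move=> hb; apply: ideal_gen_mem; apply: Or43; exists a, b. Qed.
Lemma small_nc f : ncfil d.+2 f -> small_ideal f.
Proof. by move=> hf; apply: ideal_gen_mem; apply: Or44. Qed.

Lemma small_J f : small_ideal f -> J f.
Proof.
apply: ideal_gen_min => // {}f [[a [b [ha hb ->]]]|[a [b [ha hb ->]]]|[a [b [hb ->]]]|hf].
- exact: (idealMr idJ).
- exact: (idealMl idJ).
- by apply: (idealB idJ); [apply: (idealMl idJ) | apply: (idealMr idJ)].
- by apply: ncJ; apply: ncfilS.
Qed.

Lemma one_notin_thickening_ideal : ~ J 1.
Proof. by move=> /Jker /eqP; rewrite (alg_hom1 hpi) oner_eq0. Qed.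

(** Let [KN] be the sum of step [d.+1] and [small_ideal]. By d-smoothness the quotient map to
    [F / J] lifts to a map from [F] to [F / KN] that kills [J]; [eps] represents it on generators,
    so [eps] sends [J] into [KN]. *)
Lemma retraction_exists : exists (m : 'I_n -> F) (eps : F -> F),
  [/\ forall i, J (m i), alg_hom eps, forall i, eps (x i) = x i - m i
    & forall f, J f -> exists2 u, ncfil d.+1 u & small_ideal (eps f - u)].
Proof.
pose KN f := exists2 u, ncfil d.+1 u & small_ideal (f - u).
have idKN : is_ideal KN by apply: ideal_sum_ideals => //; apply: ncfil_ideal.
have KNJ f : KN f -> J f.
  by case=> u /ncJ Ju /small_J h; apply: (ideal_sub_mem idJ h).
have [Q [q [hq sq kq]]] := ideal_quotient idJ one_notin_thickening_ideal.
have [Q' [q' [hq' sq' kq']]] := ideal_quotient idKN (fun h => one_notin_thickening_ideal (KNJ _ h)).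
have [p hp pE] : exists2 p : Q' -> Q, alg_hom p & forall f, p (q' f) = q f.
  by apply: factor_hom => // f /kq' /KNJ /kq.
have sp : surj p by move=> y; have [f <-] := sq y; exists (q' f).
have nQ : nc_nilpotent Q d.
  by apply: (nc_nilpotent_quotient hq sq) => f /ncJ /kq.
have nQ' : nc_nilpotent Q' d.
  apply: (nc_nilpotent_quotient hq' sq') => f hf; apply/kq'; exists f => //.
  by rewrite subrr; apply: ideal0.
(* The kernel is [J / KN], of square zero because [J * J] lies in [small_ideal]. *)
have np : nilpotent_pred (fun y : Q' => p y = 0).
  exists 2%N => a ha; rewrite big_ord_recl big_ord1.
  move: (ha ord0) (ha (lift ord0 ord0)).
  have [f <-] := sq' (a ord0); have [g <-] := sq' (a (lift ord0 ord0)).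
  rewrite !pE -(alg_homM hq') => /kq Jf /kq Jg; apply/kq'.
  exists 0; first exact: ncfil_zero.
  by rewrite subr0; apply: small_mulr => //; apply: Jker.
case: hJ => _ _ _ _ lJ.
have [s [hs sJ sE]] := lJ _ _ _ nQ' nQ hp sp np q hq (fun f Jf => (kq f).2 Jf).
have /choice [y yE] : forall i, exists y, q' y = s (x i) by move=> i; apply: sq'.
have [eps heps epsE] := freeF.2 F y.
exists (fun i => x i - y i), eps; split=> // [i|i|f Jf].
- by apply/kq; rewrite (alg_homB hq) -sE -yE pE subrr.
- by rewrite subKr epsE.
- have sq'E : s =1 q' \o eps.
    apply: (hom_eq_gens genF) => //; first exact: alg_hom_comp.
    by move=> i /=; rewrite epsE yE.
  by apply/kq'; have := sq'E f; rewrite sJ.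
Qed.

Section Retraction.
Variables (m : 'I_n -> F) (eps eta : F -> F).
Hypothesis Jm : forall i, J (m i).
Hypotheses (heps : alg_hom eps) (epsE : forall i, eps (x i) = x i - m i).
Hypotheses (heta : alg_hom eta) (etaE : forall i, eta (x i) = x i + m i).
Hypothesis epsJ : forall f, J f -> exists2 u, ncfil d.+1 u & small_ideal (eps f - u).

Definition next_ideal (f : F) : Prop := J f /\ small_ideal (eps f).

Lemma eps_id f : J (eps f - f).
Proof.
apply: (hom_congr_gens genF idJ heps (alg_hom_id F)) => i.
by rewrite epsE addrAC subrr add0r; apply: (idealN idJ).
Qed.

Lemma eta_id f : J (eta f - f).
Proof.
apply: (hom_congr_gens genF idJ heta (alg_hom_id F)) => i.
by rewrite etaE addrAC subrr add0r.
Qed.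

(** This is [ncfil_congr] for [eps] and the identity, with [J] in degree 0 and [small_ideal] in all
    positive degrees: a bracket, or a factor from a positive step, carries [J] into
    [small_ideal]. *)
Lemma eps_ncfil f : ncfil d.+1 f -> small_ideal (eps f - f).
Proof.
pose B k := if k is 0 then J else small_ideal.
apply: (@ncfil_congr K F F B _ _ _ _ eps id heps (alg_hom_id F) _ d.+1).
- by case.
- move=> [|k] a y; first exact: small_lie.
  by move=> hy; apply: (idealB idS); [apply: (idealMl idS) | apply: (idealMr idS)].
- move=> [|a] [|b] y z hy hz; try exact: (idealMr idS).
    exact: (idealMr idJ).
  by apply: small_mulr => //; apply: ncfil1_ker; apply: ncfilW hz.
- move=> [|a] [|b] y z hy hz; try exact: (idealMl idS).
    exact: (idealMl idJ).
  by rewrite addn0; apply: small_mull => //; apply: ncfil1_ker; apply: ncfilW hy.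
- exact: eps_id.
Qed.

Lemma eps_J f : J f -> J (eps f).
Proof. by apply: (ideal_sub_mem idJ); apply: eps_id. Qed.

Lemma eps_ker f : pi f = 0 -> pi (eps f) = 0.
Proof. by move=> hf; have /Jker := eps_id f; rewrite (alg_homB hpi) hf subr0. Qed.

Lemma eps_small f : small_ideal f -> small_ideal (eps f).
Proof.
apply: (ideal_gen_min (ideal_preim heps idS)) => {}f.
case=> [[a [b [ha hb ->]]]|[a [b [ha hb ->]]]|[a [b [hb ->]]]|hf].
- by rewrite (alg_homM heps); apply: small_mulr; [apply: eps_J | apply: eps_ker].
- by rewrite (alg_homM heps); apply: small_mull; [apply: eps_ker | apply: eps_J].
- by rewrite (alg_hom_lie heps); apply: small_lie; apply: eps_J.
- by apply: small_nc; apply: ncfil_hom.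
Qed.

(** [eps] sends [J] into step [d.+1] modulo [small_ideal], and there it is the identity modulo
    [small_ideal]. *)
Lemma eps_idem f : J f -> small_ideal (eps (eps f) - eps f).
Proof.
move=> /epsJ [u hu h]; apply: (ideal_sub_trans idS (y := eps u)).
  by rewrite -(alg_homB heps); apply: eps_small.
apply: (ideal_sub_trans idS (y := u)); first exact: eps_ncfil.
exact: (ideal_subC idS).
Qed.

(** Modulo [small_ideal], both [eta - id] and [id - eps] are derivations, because their values lie
    in [J] and the product of [J] with the kernel of [pi] is small; both take the value [m i] on the
    generator [x i]. *)
Lemma eta_reflects f : small_ideal (eta f - f - (f - eps f)).
Proof.
elim: (genF f) => {f} [f /codomP[i ->]||a b _ ha _ hb|c a _ ha|a b _ ha _ hb].
- rewrite etaE epsE subKr [x i + _]addrC addrK subrr; exact: (ideal0 idS).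
- rewrite (alg_hom1 heps) (alg_hom1 heta) !subrr; exact: (ideal0 idS).
- have sE u v w z : u + v - (w + z) = u - w + (v - z) :> F by rewrite opprD addrACA.
  rewrite (alg_homD heps) (alg_homD heta) (sE (eta a)) (sE a).
  exact: (ideal_subD idS).
- rewrite (alg_homZ heps) (alg_homZ heta) -!scalerBr; exact: (idealZ idS).
rewrite (alg_homM heps) (alg_homM heta).
have -> : eta a * eta b - a * b = (eta a - a) * eta b + a * (eta b - b).
  by rewrite mulrBl mulrBr addrA subrK.
have -> : a * b - eps a * eps b = (a - eps a) * b + eps a * (b - eps b).
  by rewrite mulrBl mulrBr addrA subrK.
have Jaa : J (a - eps a) by apply: (ideal_subC idJ); apply: eps_id.
apply: (ideal_subD idS).
  apply: (ideal_sub_trans idS (y := (a - eps a) * eta b)).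
    by rewrite -mulrBl; apply: (idealMr idS).
  by rewrite -mulrBr; apply: small_mulr => //; apply: Jker; apply: eta_id.
apply: (ideal_sub_trans idS (y := a * (b - eps b))).
  by rewrite -mulrBr; apply: (idealMl idS).
rewrite -mulrBl; apply: small_mulr => //.
by apply: Jker; apply: (ideal_subC idJ); apply: eps_id.
Qed.

Let theta : F -> F := eps \o eta.

Lemma theta_hom : alg_hom theta. Proof. exact: alg_hom_comp. Qed.

Lemma next_ideal_ideal : is_ideal next_ideal.
Proof.
have idP := ideal_preim heps idS.
split=> [|f g [? ?] [? ?]|a f [? ?]|a f [? ?]]; split.
- exact: (ideal0 idJ).
- exact: (ideal0 idP).
- exact: (idealD idJ).
- exact: (idealD idP).
- exact: (idealMl idJ).
- exact: (idealMl idP).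
- exact: (idealMr idJ).
- exact: (idealMr idP).
Qed.

(** On a generator the difference is [eps (m i) - m i], which lies in [J] and which [eps] sends into
    [small_ideal] by idempotence on [J]. *)
Lemma theta_id f : next_ideal (theta f - f).
Proof.
apply: (hom_congr_gens genF next_ideal_ideal theta_hom (alg_hom_id F)) => i.
have -> : theta (x i) - x i = eps (m i) - m i.
  by rewrite /theta /= etaE (alg_homD heps) epsE addrAC [x i - _]addrC addrK addrC.
split; first exact: eps_id.
by rewrite (alg_homB heps); apply: eps_idem.
Qed.

(** Modulo [small_ideal], [theta f] is [2 eps f - eps (eps f)], which on [J] reduces to [eps f]. *)
Lemma theta_next f : next_ideal f -> small_ideal (theta f).
Proof.
case=> Jf hf; have h := eps_small (eta_reflects f).
rewrite !(alg_homB heps) in h.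
apply: (ideal_sub_mem idS) hf; apply: (ideal_sub_mem idS h).
by apply: (ideal_subC idS); apply: eps_idem.
Qed.

(** The element [u] of step [d.+1] approximates [eps f]; since [eps] fixes [u] modulo [small_ideal],
    it sends [f - u] into [small_ideal]. *)
Lemma J_next f : J f -> exists2 u, ncfil d.+1 u & next_ideal (f - u).
Proof.
move=> Jf; have [u hu h] := epsJ Jf; exists u => //; split.
  by apply: (idealB idJ) => //; apply: ncJ.
rewrite (alg_homB heps); apply: (ideal_sub_trans idS h).
by apply: (ideal_subC idS); apply: eps_ncfil.
Qed.

(** Modulo step [d.+1] of both algebras, d-smoothness of [F / J] gives a lift [t]. A map [h] from
    [F] to [L'] is chosen on generators to lift both [t] and [g]. It kills [small_ideal] but perhaps
    not [next_ideal]; composing with [theta] repairs this. *)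
Lemma next_lifts : lifts_mod d.+1 next_ideal.
Proof.
move=> L' L p nL' nL hp sp [k nilp] g hg gJ.
have [M [q [hq sq kq nM]]] := ncfil_quotient d nL.
have [M' [q' [hq' sq' kq' nM']]] := ncfil_quotient d nL'.
have hqp := alg_hom_comp hp hq.
have [|r hr rE] := factor_hom hq' sq' hqp.
  by move=> y /kq' hy; apply/kq; apply: ncfil_hom.
have sr : surj r.
  by move=> z; have [y <-] := sq z; have [w <-] := sp y; exists (q' w); rewrite rE.
(* [p] maps step [d.+1] of [L'] onto that of [L], so [w] can be moved within its class to a preimage
   of [y]. *)
have adjust w y : q (p w) = q y -> exists2 v, q' v = q' w & p v = y.
  move=> h; have /kq : q (p w - y) = 0 by rewrite (alg_homB hq) h subrr.
  move=> /(ncfil_surj hp sp) [v /kq' hv pv]; exists (w - v).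
    by rewrite (alg_homB hq') hv subr0.
  by rewrite (alg_homB hp) pv subKr.
(* By [adjust] every element of the kernel of [r] lifts to the kernel of [p], so the exponent [k]
   carries over. *)
have nr : nilpotent_pred (fun z : M' => r z = 0).
  exists k => a ha.
  have /choice [y yE] : forall j, exists y, q' y = a j /\ p y = 0.
    move=> j; have [w wE] := sq' (a j).
    have [|v v1 v2] := adjust w 0; last by exists v; rewrite v1.
    by rewrite -[LHS]rE wE ha (alg_hom0 hq).
  under eq_bigr => j _ do rewrite -(yE j).1.
  rewrite -(alg_hom_prod hq') nilp ?(alg_hom0 hq') // => j.
  exact: (yE j).2.
have hqg := alg_hom_comp hg hq.
have qgJ f : J f -> (q \o g) f = 0.
  move=> /J_next [u hu /gJ /(alg_hom_sub_eq0 hg) /= ->].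
  by apply/kq; apply: ncfil_hom.
case: hJ => _ _ _ _ /(_ _ _ _ nM' nM hr sr nr _ hqg qgJ) [t [ht tJ tE]].
have /choice [y yE] : forall i, exists y, q' y = t (x i) /\ p y = g (x i).
  move=> i; have [w wE] := sq' (t (x i)).
  have [|v v1 v2] := adjust w (g (x i)); last by exists v; rewrite v1.
  by rewrite -[LHS]rE wE tE.
have [h hh hE] := freeF.2 L' y.
have phE : p \o h =1 g.
  apply: (hom_eq_gens genF) => //; first exact: alg_hom_comp.
  by move=> i /=; rewrite hE (yE i).2.
have qhE : q' \o h =1 t.
  apply: (hom_eq_gens genF) => //; first exact: alg_hom_comp.
  by move=> i /=; rewrite hE (yE i).1.
have hJd f : J f -> ncfil d.+1 (h f) by move=> Jf; apply/kq'; rewrite -(tJ f Jf) -qhE.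
have hker f : pi f = 0 -> ncfil 1 (h f).
  move=> /kerJ [u hu /hJd]; rewrite (alg_homB hh) => huf.
  apply: (ideal_sub_mem (ncfil_ideal L' 1) (y := h u)); last exact: ncfil_hom.
  exact: ncfilW huf.
have hS f : small_ideal f -> h f = 0.
  apply: (ideal_gen_min (ideal_ker hh)) => {}f hf.
  apply: ((nc_nilpotentP _ _).1 nL').
  case: hf => [[a [b [ha hb ->]]]|[a [b [ha hb ->]]]|[a [b [hb ->]]]|hf].
  - by rewrite (alg_homM hh) -addn1; apply: ncfil_mul; [apply: hJd | apply: hker].
  - by rewrite (alg_homM hh) -add1n; apply: ncfil_mul; [apply: hker | apply: hJd].
  - by rewrite (alg_hom_lie hh); apply: ncfil_lie; apply: hJd.
  - exact: ncfil_hom.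
exists (h \o theta); split.
- exact: (alg_hom_comp theta_hom).
- by move=> f /theta_next /hS.
- by move=> f; have /gJ /(alg_hom_sub_eq0 hg) := theta_id f; rewrite -phE.
Qed.

Lemma next_thickening : thickening_ideal d.+1 next_ideal.
Proof.
split.
- exact: next_ideal_ideal.
- move=> f hf; split; first by apply: ncJ; apply: ncfilS.
  by apply: small_nc; apply: ncfil_hom.
- by move=> f [/Jker].
- move=> f /kerJ [u hu /J_next [v hv hn]]; exists (u + v); last by rewrite opprD addrA.
  by apply: ncfil_add => //; apply: ncfilW hv.
- exact: next_lifts.
Qed.

End Retraction.

Lemma thickening_ideal_step : exists J', [/\ thickening_ideal d.+1 J',
  forall f, J' f -> J f & forall f, J f -> exists2 u, ncfil d.+1 u & J' (f - u)].
Proof.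
have [m [eps [Jm heps epsE epsJ]]] := retraction_exists.
have [eta heta etaE] := freeF.2 F (fun i => x i + m i).
exists (next_ideal eps); split.
- exact: (next_thickening Jm heps epsE heta etaE epsJ).
- by move=> f [].
- exact: (J_next Jm heps epsE epsJ).
Qed.

End Step.

(** * The d-smooth thickening as a quotient of the free algebra *)

Section Existence.
Hypotheses (spi : surj pi) (smA : smooth_comm A).

Lemma d_smooth_quotient d J : thickening_ideal d J ->
  exists (R : algType K) (phi : R -> A), d_smooth R d /\ ab_iso phi.
Proof.
move=> [idJ ncJ Jker kerJ lJ].
have J1 : ~ J 1 by move=> /Jker /eqP; rewrite (alg_hom1 hpi) oner_eq0.
have [R [q [hq sq kq]]] := ideal_quotient idJ J1.
have [phi hphi phiE] : exists2 phi : R -> A, alg_hom phi & forall f, phi (q f) = pi f.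
  by apply: factor_hom => // f /kq /Jker.
exists R, phi; split; split=> //.
- exists (map q (codom x)) => y; have [f <-] := sq y.
  exact: subalg_gen_hom.
- by apply: (nc_nilpotent_quotient hq sq) => f /ncJ /kq.
- move=> L' L p nL' nL hp sp np f hf _.
  have hfq := alg_hom_comp hq hf.
  have fqJ y : J y -> (f \o q) y = 0 by move=> /kq /= ->; apply: alg_hom0.
  have [g [hg gJ gE]] := lJ _ _ _ nL' nL hp sp np _ hfq fqJ.
  have [h hh hE] : exists2 h : R -> L', alg_hom h & forall y, h (q y) = g y.
    by apply: factor_hom => // y /kq /gJ.
  exists h; split=> // y.
    by move=> /ncF_ncfil; apply: (ncfil_hom_eq0 hh nL').
  by have [w <-] := sq y; rewrite hE gE.
- by move=> a; have [f <-] := spi a; exists (q f).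
- move=> y; split=> [|/ncfil1_comm_ideal hy]; last first.
    by apply: (ncfil1_eq0 comA); apply: ncfil_hom.
  have [f <-] := sq y; rewrite phiE => /kerJ [u hu /kq /(alg_hom_sub_eq0 hq) ->].
  by apply/ncfil1_comm_ideal; apply: ncfil_hom.
Qed.

End Existence.

(** * Generation of the filtration by finitely many operators *)

Definition ncop (S : algType K) (y : 'I_n -> S) (al : 'I_n + 'I_n * 'I_n) (p : S) : S :=
  match al with
  | inl i => lie (y i) p
  | inr ij => lie (y ij.1) (y ij.2) * p
  end.

Section NcOp.
Variables (S : algType K) (y : 'I_n -> S).

Lemma ncopD al p q : ncop y al (p + q) = ncop y al p + ncop y al q.
Proof. by case: al => [i|[i j]] /=; rewrite ?lieDr ?mulrDr. Qed.
Lemma ncopZ al c p : ncop y al (c *: p) = c *: ncop y al p.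
Proof. by case: al => [i|[i j]] /=; rewrite ?lieZr -?scalerAr. Qed.
Lemma ncop0 al : ncop y al 0 = 0.
Proof. by rewrite -(scale0r 0) ncopZ !scale0r. Qed.
Lemma ncopB al p q : ncop y al (p - q) = ncop y al p - ncop y al q.
Proof. by rewrite ncopD -scaleN1r ncopZ scaleN1r. Qed.
Lemma ncop_ideal (J : S -> Prop) al p : is_ideal J -> J p -> J (ncop y al p).
Proof.
move=> hJ Jp; case: al => [i|[i j]] /=; last exact: (idealMl hJ).
by apply: (idealB hJ); [apply: (idealMl hJ) | apply: (idealMr hJ)].
Qed.
Lemma ncfil_ncop al d p : ncfil d p -> ncfil d.+1 (ncop y al p).
Proof.
move=> hp; case: al => [i|[i j]] /=; first exact: ncfil_lie.
by rewrite -add1n; apply: ncfil_mul => //; apply: ncfil_lie; apply: ncfil_all.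
Qed.

End NcOp.

Lemma ncop_hom (S T : algType K) (y : 'I_n -> S) (f : S -> T) al p :
  alg_hom f -> f (ncop y al p) = ncop (f \o y) al (f p).
Proof.
by move=> hf; case: al => [i|[i j]] /=; rewrite ?(alg_homM hf) !(alg_hom_lie hf).
Qed.

Section Generation.

Let spanned k f := exists p : 'I_n + 'I_n * 'I_n -> F,
  (forall al, ncfil k (p al)) /\ ncfil k.+2 (f - \sum_al ncop x al (p al)).

Let spanned_nc k f : ncfil k.+2 f -> spanned k f.
Proof.
move=> hf; exists (fun=> 0); split=> [al|]; first exact: ncfil_zero.
by rewrite big1 ?subr0 // => al _; apply: ncop0.
Qed.

Let spanned0 k : spanned k 0.
Proof. by apply: spanned_nc; apply: ncfil_zero. Qed.

Let spannedD k f g : spanned k f -> spanned k g -> spanned k (f + g).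
Proof.
move=> [p [hp hf]] [q [hq hg]]; exists (fun al => p al + q al); split=> [al|].
  exact: ncfil_add.
under eq_bigr do rewrite ncopD; rewrite big_split /=.
exact: (ideal_subD (ncfil_ideal F k.+2)).
Qed.

Let spannedZ k c f : spanned k f -> spanned k (c *: f).
Proof.
move=> [p [hp hf]]; exists (fun al => c *: p al); split=> [al|].
  exact: (idealZ (ncfil_ideal F k)).
under eq_bigr do rewrite ncopZ; rewrite -scaler_sumr.
exact: (ideal_subZ (ncfil_ideal F k.+2)).
Qed.

Let spanned_ncop k al p : ncfil k p -> spanned k (ncop x al p).
Proof.
move=> hp; exists (fun be => if be == al then p else 0); split=> [be|].
  by case: eqP => // _; apply: ncfil_zero.
rewrite (bigD1 al) //= eqxx big1 ?addr0 ?subrr; first exact: ncfil_zero.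
by move=> be /negPf ->; apply: ncop0.
Qed.

(** Moving [c] across [f] costs the commutator [lie c f], whose product with [g] is negligible
    modulo step [k.+2]. *)
Let spanned_swap k c f g : ncfil k.+2 (lie c f * g) -> spanned k (f * (c * g)) ->
  spanned k (c * f * g).
Proof.
move=> h1 h2; have -> : c * f * g = lie c f * g + f * (c * g).
  by rewrite /lie mulrBl -[f * c * g]mulrA subrK.
by apply: spannedD => //; apply: spanned_nc.
Qed.

Let spanned_lie_gens b i g y : ncfil b y -> spanned b (lie (x i) g * y).
Proof.
elim: (genF g) y => {g} [g /codomP[j ->]||g h _ hg _ hh|c g _ hg|g h _ hg _ hh] y hy.
- exact: (spanned_ncop (inr (i, j))).
- by rewrite lie1r mul0r.
- by rewrite lieDr mulrDl; apply: spannedD; [apply: hg | apply: hh].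
- by rewrite lieZr -scalerAl; apply: spannedZ; apply: hg.
- rewrite lieMr mulrDl; apply: spannedD.
    by rewrite -mulrA; apply: hg; apply: (idealMl (ncfil_ideal F b)).
  apply: spanned_swap; last by apply: hh; apply: (idealMl (ncfil_ideal F b)).
  rewrite -[b.+2]/(2 + b)%N; apply: ncfil_mul => //.
  by do 2!apply: ncfil_lie; apply: ncfil_all.
Qed.

(** The trailing factor [y] is arbitrary so that the induction can transfer factors to it. For a
    generator, [lie (x i) u * y] is [lie (x i) (u * y)] minus [u * lie (x i) y], and the induction
    on [u] covers the last term; brackets with other elements expand over the generators. *)
Let spanned_mul a u : ncfil a u ->
  forall k b y, ncfil b y -> (a + b = k.+1)%N -> (0 < a)%N -> spanned k (u * y).
Proof.
elim=> {a u} //.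
- move=> d c u hu IH k b y hy [<-] _ {k}.
  elim: (genF c) y hy => {c} [c /codomP[i ->]||c e _ hc _ he|t c _ hc|c e _ hc _ he] y hy.
  + case: d hu IH => [|d] hu IH; first exact: spanned_lie_gens.
    have -> : lie (x i) u * y = ncop x (inl i) (u * y) + (-1) *: (u * lie (x i) y).
      by rewrite /= lieMr scaleN1r addrK.
    apply: spannedD; first by apply: spanned_ncop; apply: ncfil_mul.
    by apply: spannedZ; apply: (IH _ b.+1) => //; [apply: ncfil_lie | rewrite addnS].
  + by rewrite lie1l mul0r.
  + by rewrite lieDl mulrDl; apply: spannedD; [apply: hc | apply: he].
  + by rewrite lieZl -scalerAl; apply: spannedZ; apply: hc.
  + rewrite lieMl mulrDl; apply: spannedD; last first.
      by rewrite -mulrA; apply: hc; apply: (idealMl (ncfil_ideal F b)).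
    apply: spanned_swap; last by apply: he; apply: (idealMl (ncfil_ideal F b)).
    rewrite -[(d + b).+2]/(d.+2 + b)%N; apply: ncfil_mul => //.
    by do 2!apply: ncfil_lie.
- by move=> d k b y _ _ _; rewrite mul0r.
- move=> d u v _ hu _ hv k b y hy e d0; rewrite mulrDl.
  by apply: spannedD; [apply: (hu k b) | apply: (hv k b)].
- move=> [|a] c u v hu IHu hv IHv k b y hy e a0; last first.
    rewrite -mulrA; apply: (IHu k (c + b)%N) => //; first exact: ncfil_mul.
    by rewrite addnA.
  rewrite add0n in e a0; apply: spanned_swap; last first.
    by apply: (IHv k b) => //; apply: (idealMl (ncfil_ideal F b)).
  by rewrite -e -addSn; apply: ncfil_mul => //; apply: ncfil_lie.
Qed.

(* Only finitely many operators [ncop x al] are needed to reach each step of the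
   filtration from the previous one: this makes the steps closed in the limit. *)
Lemma ncfil_generation k f : ncfil k.+1 f ->
  exists p : 'I_n + 'I_n * 'I_n -> F,
    (forall al, ncfil k (p al)) /\ ncfil k.+2 (f - \sum_al ncop x al (p al)).
Proof.
move=> hf; rewrite -[f]mulr1.
by apply: (spanned_mul hf (b := 0)) => //; [apply: ncfil_all | rewrite addn0].
Qed.

End Generation.

(** * The chain of thickening ideals and its inverse limit *)

Lemma thickening_chain : surj pi -> smooth_comm A ->
  exists J : nat -> F -> Prop, [/\ forall d, thickening_ideal d (J d),
    forall d f, J d.+1 f -> J d f &
    forall d f, J d f -> exists2 u, ncfil d.+1 u & J d.+1 (f - u)].
Proof.
move=> spi smA.
have /choice [next nextP] : forall dJ : nat * (F -> Prop), exists J',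
    thickening_ideal dJ.1 dJ.2 -> [/\ thickening_ideal dJ.1.+1 J',
      forall f, J' f -> dJ.2 f &
      forall f, dJ.2 f -> exists2 u, ncfil dJ.1.+1 u & J' (f - u)].
  (* A predicate that is not a thickening ideal is returned unchanged; the chain never meets this
     case. *)
  move=> [d J] /=; have [/thickening_ideal_step [J' hJ']|nJ] := pselect (thickening_ideal d J).
    by exists J'.
  by exists J.
pose J := fix J d := if d is e.+1 then next (e, J e) else (fun f => pi f = 0).
have hJ d : thickening_ideal d (J d).
  elim: d => [|d IH]; first exact: thickening_ideal0.
  by have [] := nextP (d, J d) IH.
by exists J; split=> // d; have [] := nextP (d, J d) (hJ d).
Qed.

Section Limit.
Variable J : nat -> F -> Prop.
Hypothesis thJ : forall d, thickening_ideal d (J d).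
Hypothesis JS : forall d f, J d.+1 f -> J d f.
Hypothesis Jgap : forall d f, J d f -> exists2 u, ncfil d.+1 u & J d.+1 (f - u).

Let idJ d : is_ideal (J d). Proof. by case: (thJ d). Qed.
Let ncJ d f : ncfil d.+1 f -> J d f. Proof. by case: (thJ d) => _ h _ _ _; apply: h. Qed.
Let Jker d f : J d f -> pi f = 0. Proof. by case: (thJ d) => _ _ h _ _; apply: h. Qed.

(* [R] is the inverse limit of the [F / J d] and [Z d] is the kernel of its
   projection to [F / J d]. *)
Definition is_limit (R : algType K) (c : F -> R) (Z : nat -> R -> Prop) : Prop :=
  [/\ alg_hom c, forall d, is_ideal (Z d), forall d f, Z d (c f) <-> J d f,
      (forall d r, Z d.+1 r -> Z d r) /\ (forall r, (forall d, Z d r) -> r = 0) &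
      (forall d r, exists f, Z d (r - c f)) /\
      (forall s : nat -> F, (forall d, J d (s d.+1 - s d)) ->
         exists r, forall d, Z d (r - c (s d)))].

Definition cauchy (s : nat -> F) := forall d, J d (s d.+1 - s d).

Lemma cauchy_const f : cauchy (fun=> f).
Proof. by move=> d; rewrite subrr; apply: ideal0. Qed.
Lemma cauchyD s t : cauchy s -> cauchy t -> cauchy (fun d => s d + t d).
Proof. by move=> hs ht d; apply: ideal_subD. Qed.
Lemma cauchyM s t : cauchy s -> cauchy t -> cauchy (fun d => s d * t d).
Proof. by move=> hs ht d; apply: ideal_subM. Qed.
Lemma cauchyZ a s : cauchy s -> cauchy (fun d => a *: s d).
Proof. by move=> hs d; apply: ideal_subZ. Qed.

Lemma limit_exists : exists (R : algType K) (c : F -> R) (Z : nat -> R -> Prop), is_limit c Z.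
Proof.
pose T := {s : nat -> F | cauchy s}.
pose cst f : T := exist cauchy _ (cauchy_const f).
pose addT (s t : T) : T := exist cauchy _ (cauchyD (proj2_sig s) (proj2_sig t)).
pose mulT (s t : T) : T := exist cauchy _ (cauchyM (proj2_sig s) (proj2_sig t)).
pose scT a (s : T) : T := exist cauchy _ (cauchyZ a (proj2_sig s)).
pose E (s t : T) := forall d, J d (proj1_sig s d - proj1_sig t d).
have eE (s t : T) : proj1_sig s =1 proj1_sig t -> E s t.
  by move=> h d; rewrite h subrr; apply: ideal0.
have [|||||||||||||||||||||||R [p [sp pE pD pZ [pM p1]]]] := @setoid_alg_quotient K T
  E (cst 0) (cst 1) (scT (-1)) addT mulT scT.
- by move=> s; apply: eE.
- by move=> s t h d; apply: ideal_subC.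
- by move=> s t u h1 h2 d; apply: (ideal_sub_trans (idJ d) (h1 d) (h2 d)).
- by move=> s t h d; apply: ideal_subZ.
- by move=> s s' t t' h1 h2 d; apply: ideal_subD.
- by move=> s s' t t' h1 h2 d; apply: ideal_subM.
- by move=> a s t h d; apply: ideal_subZ.
- by move=> s t u; apply: eE => d /=; rewrite addrA.
- by move=> s t; apply: eE => d /=; rewrite addrC.
- by move=> s; apply: eE => d /=; rewrite add0r.
- by move=> s; apply: eE => d /=; rewrite scaleN1r addNr.
- by move=> s t u; apply: eE => d /=; rewrite mulrA.
- by move=> s; apply: eE => d /=; rewrite mul1r.
- by move=> s; apply: eE => d /=; rewrite mulr1.
- by move=> s t u; apply: eE => d /=; rewrite mulrDl.
- by move=> s t u; apply: eE => d /=; rewrite mulrDr.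
- by move=> a b s; apply: eE => d /=; rewrite scalerA.
- by move=> s; apply: eE => d /=; rewrite scale1r.
- by move=> a s t; apply: eE => d /=; rewrite scalerDr.
- by move=> s a b; apply: eE => d /=; rewrite scalerDl.
- by move=> a s t; apply: eE => d /=; rewrite scalerAl.
- by move=> a s t; apply: eE => d /=; rewrite scalerAr.
- by move=> /(_ 0%N) /=; rewrite subr0 => /Jker /eqP; rewrite (alg_hom1 hpi) oner_eq0.
pose Z d r := exists2 t, p t = r & J d (proj1_sig t d).
have ZE d t : Z d (p t) <-> J d (proj1_sig t d).
  split=> [[s /pE /(_ d) h hs]|h]; last by exists t.
  by apply: (ideal_sub_mem (idJ d)) hs; apply: ideal_subC.
have hc : alg_hom (p \o cst).
  split=> [f g|a f|f g|] //=.
  - by rewrite -pD; apply/pE; apply: eE.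
  - by rewrite -pZ; apply/pE; apply: eE.
  - by rewrite -pM; apply/pE; apply: eE.
have p0 : p (cst 0) = 0 by rewrite -[RHS](alg_hom0 hc).
have pB s t : p s - p t = p (addT s (scT (-1) t)) by rewrite pD pZ scaleN1r.
exists R, (p \o cst), Z; split=> //.
- move=> d; split.
  + by rewrite -p0; apply/ZE; apply: ideal0.
  + move=> _ _ [s <- hs] [t <- ht]; rewrite -pD; apply/ZE; exact: (idealD (idJ d)).
  + move=> r _ [s <- hs]; have [t <-] := sp r; rewrite -pM; apply/ZE.
    exact: (idealMl (idJ d)).
  + move=> r _ [s <- hs]; have [t <-] := sp r; rewrite -pM; apply/ZE.
    exact: (idealMr (idJ d)).
- move=> d f; exact: (ZE d (cst f)).
- split=> [d _ [s <- /JS hs]|r].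
    by apply/ZE; apply: (ideal_sub_mem (idJ d) _ hs); apply: ideal_subC => //; apply: (proj2_sig s d).
  have [t <-] := sp r => h; rewrite -p0; apply/pE => d /=.
  by rewrite subr0; apply/ZE.
- split=> [d r|s hs].
    have [t <-] := sp r; exists (proj1_sig t d); rewrite /= pB; apply/ZE => /=.
    by rewrite scaleN1r subrr; apply: ideal0.
  exists (p (exist cauchy s hs)) => d; rewrite /= pB; apply/ZE => /=.
  by rewrite scaleN1r subrr; apply: ideal0.
Qed.

Section LimitTheory.
Variables (R : algType K) (c : F -> R) (Z : nat -> R -> Prop).
Hypothesis limR : is_limit c Z.

Let hc : alg_hom c. Proof. by case: limR. Qed.
Let idZ d : is_ideal (Z d). Proof. by case: limR. Qed.
Let Zc d f : Z d (c f) <-> J d f. Proof. by case: limR. Qed.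
Let ZS d r : Z d.+1 r -> Z d r. Proof. by case: limR => _ _ _ [h _] _; apply: h. Qed.
Let Z_sep r : (forall d, Z d r) -> r = 0. Proof. by case: limR => _ _ _ [_ h] _; apply: h. Qed.
Let Z_dense d r : exists f, Z d (r - c f).
Proof. by case: limR => _ _ _ _ [h _]; apply: h. Qed.
Let Z_complete (s : nat -> F) : (forall d, J d (s d.+1 - s d)) ->
  exists r, forall d, Z d (r - c (s d)).
Proof. by case: limR => _ _ _ _ [_]; apply. Qed.

Let ZW d e r : (d <= e)%N -> Z e r -> Z d r.
Proof.
move=> /subnK <-; elim: (e - d)%N => [//|k IH].
by rewrite addSn => /ZS.
Qed.

Lemma limit_quotient d : exists (Q : algType K) (q : R -> Q),
  [/\ alg_hom q, surj (q \o c) & forall r, q r = 0 <-> Z d r].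
Proof.
have Z1 : ~ Z d 1.
  rewrite -(alg_hom1 hc) => /Zc /Jker /eqP.
  by rewrite (alg_hom1 hpi) oner_eq0.
have [Q [q [hq sq kq]]] := ideal_quotient (idZ d) Z1.
exists Q, q; split=> // y; have [r <-] := sq y.
by have [f /kq /(alg_hom_sub_eq0 hq) ->] := Z_dense d r; exists f.
Qed.

Lemma limit_factor d (L : algType K) (g : F -> L) :
  alg_hom g -> (forall f, J d f -> g f = 0) ->
  exists2 G : R -> L, alg_hom G &
    (forall f, G (c f) = g f) /\ (forall r, Z d r -> G r = 0).
Proof.
move=> hg gJ; have [Q [q [hq sqc kq]]] := limit_quotient d.
have [|h hh hE] := factor_hom (alg_hom_comp hc hq) sqc hg.
  by move=> f /kq /Zc /gJ.
exists (h \o q); first exact: alg_hom_comp.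
by split=> [|r /kq /= ->]; [exact: hE | exact: alg_hom0].
Qed.

Lemma ncfil_Z d r : ncfil d.+1 r -> Z d r.
Proof.
have [Q [q [hq sqc kq]]] := limit_quotient d.
move=> /(ncfil_hom hq) /(ncfil_surj (alg_hom_comp hc hq) sqc) [u /ncJ /Zc hu huE].
by apply/kq; rewrite -huE; apply/kq.
Qed.

(** Modulo [Z m.+1], an element of [Z m] comes from [J m], hence from step [m.+1] by [Jgap]. Then
    [ncfil_generation] applies, and its error in step [m.+2] lies in [J m.+1]. *)
Lemma limit_step m r : Z m r -> exists q : 'I_n + 'I_n * 'I_n -> F,
  (forall al, ncfil m (q al)) /\ Z m.+1 (r - \sum_al ncop (c \o x) al (c (q al))).
Proof.
move=> hr; have [f hf] := Z_dense m.+1 r.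
have /Zc /Jgap [u hu hfu] : Z m (c f).
  by apply: (ideal_sub_mem (idZ m)) hr; apply: ideal_subC => //; apply: ZS.
have [q [hq hs]] := ncfil_generation hu; exists q; split=> //.
apply: (ideal_sub_trans (idZ m.+1) hf).
have -> : \sum_al ncop (c \o x) al (c (q al)) = c (\sum_al ncop x al (q al)).
  rewrite (big_morph c (alg_homD hc) (alg_hom0 hc)).
  by apply: eq_bigr => al _; rewrite (ncop_hom _ _ _ hc).
rewrite -(alg_homB hc); apply/Zc; apply: (ideal_sub_trans (idJ m.+1) hfu).
exact: ncJ.
Qed.

(** Successive approximation by [limit_step]: the arguments of each operator form a convergent
    series, and the operators are continuous since they preserve ideals. The form [k = j.+1] leaves
    [P al] unconstrained when [k] is 0. *)
Lemma limit_closed k r : Z k r -> exists P : 'I_n + 'I_n * 'I_n -> R,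
  (forall al j, k = j.+1 -> Z j (P al)) /\
  r = \sum_al ncop (c \o x) al (P al).
Proof.
move=> hr.
have /choice [q qP] : forall ms : nat * R, exists q : 'I_n + 'I_n * 'I_n -> F,
    Z ms.1 ms.2 -> (forall al, ncfil ms.1 (q al)) /\
    Z ms.1.+1 (ms.2 - \sum_al ncop (c \o x) al (c (q al))).
  move=> [m s] /=; have [/limit_step [q hq]|nZ] := pselect (Z m s).
    by exists q.
  by exists (fun=> 0).
(* The remainder after [j] rounds; it lies in [Z (k + j)]. *)
pose rr := fix rr j := if j is i.+1 then
  rr i - \sum_al ncop (c \o x) al (c (q ((k + i)%N, rr i) al)) else r.
have rrZ j : Z (k + j) (rr j).
  elim: j => [|j IH]; first by rewrite addn0.
  by rewrite addnS; have [] := qP ((k + j)%N, rr j) IH.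
have qnc j al : ncfil (k + j) (q ((k + j)%N, rr j) al).
  by have [h _] := qP ((k + j)%N, rr j) (rrZ j); apply: h.
pose s al j := \sum_(i < j) q ((k + i)%N, rr i) al.
have sS al j : s al j.+1 = s al j + q ((k + j)%N, rr j) al by rewrite /s big_ord_recr.
have rE j : r - \sum_al ncop (c \o x) al (c (s al j)) = rr j.
  elim: j => [|j IH].
    rewrite big1 ?subr0 // => al _.
    by rewrite /s big_ord0 (alg_hom0 hc) ncop0.
  rewrite /= -{1}IH -addrA -opprD -big_split /=; congr (_ - _).
  by apply: eq_bigr => al _; rewrite sS (alg_homD hc) ncopD.
have sk al j : ncfil k (s al j).
  rewrite /s; elim/big_ind: _ => [||i _]; [exact: ncfil_zero | exact: ncfil_add |].
  exact: ncfilW (leq_addr _ _) (qnc i al).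
(* The shift to [d.+1] makes the increment at [d] lie in step [k + d.+1], hence in step [d.+1],
   which [J d] contains. *)
have /choice [P PE] : forall al, exists y, forall d, Z d (y - c (s al d.+1)).
  move=> al; apply: (Z_complete (s := fun d => s al d.+1)) => d.
  rewrite [s al d.+2]sS addrC addKr; apply: ncJ.
  exact: ncfilW (leq_addl _ _) (qnc d.+1 al).
exists P; split=> [al j ej|].
  apply: (ideal_sub_mem (idZ j) (PE al j)); apply/Zc; apply: ncJ.
  by rewrite -ej; apply: sk.
apply/eqP; rewrite -subr_eq0; apply/eqP; apply: Z_sep => d.
apply: (ideal_sub_trans (idZ d) (y := \sum_al ncop (c \o x) al (c (s al d.+1)))).
  by rewrite rE; apply: ZW (rrZ d.+1); apply: leq_trans (leqnSn d) (leq_addl _ _).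
rewrite -sumrB; apply: (ideal_sum (idZ d)) => al; rewrite -ncopB.
by apply: ncop_ideal => //; apply: ideal_subC.
Qed.

(** Together with [ncfil_Z] this identifies [Z k] with step [k.+1] of [R]. By [limit_closed], an
    element of [Z k.+1] is a finite sum of operators applied to [Z k], and each operator raises the
    step by one. *)
Lemma Z_ncfil k r : Z k r -> ncfil k.+1 r.
Proof.
elim: k r => [|k IH] r /limit_closed [P [hP ->]].
  apply: (ideal_sum (ncfil_ideal R 1)) => al.
  by apply: ncfil_ncop; apply: ncfil_all.
apply: (ideal_sum (ncfil_ideal R k.+2)) => al.
by apply: ncfil_ncop; apply: IH; apply: hP.
Qed.

Lemma limit_nc_complete : nc_complete R.
Proof.
split=> [r h|r h].
  by apply: Z_sep => d; apply: ncfil_Z; apply/ncF_ncfil.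
(* Approximating [r d.+1] instead of [r d] matches step [d.+1] with [Z d]. *)
have /choice [f fE] : forall d, exists f, Z d (r d.+1 - c f).
  by move=> d; apply: Z_dense.
have [|y yE] := Z_complete (s := f).
  move=> d; apply/Zc; rewrite (alg_homB hc).
  apply: (ideal_sub_trans (idZ d) (y := r d.+2)).
    by apply: ideal_subC => //; apply: ZS.
  apply: (ideal_sub_trans (idZ d) (y := r d.+1)) (fE d).
  by apply: ncfil_Z; apply/ncF_ncfil.
exists y => -[|d]; apply/ncF_ncfil; first exact: ncfil_all.
apply: Z_ncfil; apply: (ideal_sub_trans (idZ d) (yE d)).
exact: ideal_subC.
Qed.

Lemma limit_smooth d : quot_d_smooth R d.
Proof.
split.
  exists (map c (codom x)) => r; have [f /Z_ncfil hf] := Z_dense d r.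
  by exists (c f); split; [apply: subalg_gen_hom | apply/ncF_ncfil].
move=> L' L p nL' nL hp sp np f hf f0.
have fZ r : Z d r -> f r = 0.
  by move=> /Z_ncfil hr; apply: f0; apply/ncF_ncfil.
have hfc := alg_hom_comp hc hf.
have fcJ y : J d y -> (f \o c) y = 0 by move=> /Zc /fZ.
have [_ _ _ _ lJ] := thJ d.
have [g [hg gJ gE]] := lJ _ _ _ nL' nL hp sp np _ hfc fcJ.
have [G hG [GE GZ]] := limit_factor hg gJ.
exists G; split=> // r; first by move=> /ncF_ncfil /ncfil_Z /GZ.
have [y hy] := Z_dense d r.
by rewrite (alg_hom_sub_eq0 hf (fZ _ hy)) (alg_hom_sub_eq0 hG (GZ _ hy)) GE gE.
Qed.

Lemma limit_ab_iso : surj pi -> exists phi : R -> A, ab_iso phi.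
Proof.
move=> spi; have [phi hphi [phiE phiZ]] := limit_factor hpi (Jker (d := 0)).
exists phi; split=> //.
  by move=> a; have [f <-] := spi a; exists (c f).
move=> r; split=> [|/ncfil1_comm_ideal /ncfil_Z /phiZ //].
have [f hf] := Z_dense 0 r; rewrite (alg_hom_sub_eq0 hphi (phiZ _ hf)) phiE.
have [_ _ _ kerJ _] := thJ 0 => /kerJ [u /ncJ hu hfu].
apply/ncfil1_comm_ideal; apply: Z_ncfil; apply: (ideal_sub_mem (idZ 0) hf).
by apply/Zc; apply: (ideal_sub_mem (idJ 0) hfu).
Qed.

End LimitTheory.
End Limit.

End Thickening.

(** * Completeness and uniqueness of thickenings *)

Lemma nc_nilpotent_complete (K : pzRingType) (S : algType K) d :
  nc_nilpotent S d -> nc_complete S.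
Proof.
move=> nS; split=> [y h|r h]; first exact: (nS y (h d.+1)).
have nS' := (nc_nilpotentP _ _).1 nS.
have rE e k : ncfil e (r (k + e)%N - r e).
  elim: k => [|k IH]; first by rewrite subrr; apply: ncfil_zero.
  apply: (ideal_sub_trans (ncfil_ideal S e)) IH.
  exact: ncfilW (leq_addl _ _) ((ncF_ncfil _ _).1 (h _)).
(* The sequence is constant from index [d.+1] on, since its later increments lie in a zero step. *)
exists (r d.+1) => e; apply/ncF_ncfil.
have [le_ed|/ltnW le_de] := leqP e d.+1.
  by have := rE e (d.+1 - e)%N; rewrite subnK.
have := rE d.+1 (e - d.+1)%N; rewrite subnK // => /nS' /eqP.
by rewrite subr_eq0 => /eqP ->; rewrite subrr; apply: ncfil_zero.
Qed.

(* An endomorphism congruent to the identity modulo commutators acts trivially on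
   the associated graded algebra, hence is invertible by completeness. *)
Lemma unipotent_bijective (K : pzRingType) (S : algType K) (u : S -> S) :
  nc_complete S -> alg_hom u -> (forall y, ncfil 1 (u y - y)) ->
  injective u /\ surj u.
Proof.
move=> [sep cpl] hu u1.
have sep' (y : S) : (forall d, ncfil d y) -> y = 0.
  by move=> h; apply: sep => d; apply/ncF_ncfil.
have ugr d y : ncfil d y -> ncfil d.+1 (u y - y).
  apply: (@ncfil_congr K S S (fun k => ncfil k.+1) _ _ _ _ u id hu (alg_hom_id S)) => //.
  - by move=> k; apply: ncfil_ideal.
  - by move=> k a z; apply: ncfil_lie.
  - by move=> a b z w hz hw; rewrite -addSn; apply: ncfil_mul.
  - by move=> a b z w hz hw; rewrite -addnS; apply: ncfil_mul.
split=> [y z yz|y].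
  apply/eqP; rewrite -subr_eq0; apply/eqP; apply: sep'.
  elim=> [|d IH]; first exact: ncfil_all.
  have := ugr _ _ IH; rewrite (alg_homB hu) yz subrr sub0r.
  by move=> /(idealN (ncfil_ideal S d.+1)); rewrite opprK.
(* With the error [e = u (r d) - y], the next error is [e - u e], which lies one step deeper. *)
pose r := fix r d := if d is e.+1 then r e - (u (r e) - y) else 0.
have rP d : ncfil d (u (r d) - y).
  elim: d => [|d IH]; first exact: ncfil_all.
  rewrite /= (alg_homB hu) addrAC -opprB; apply: (idealN (ncfil_ideal S d.+1)).
  exact: ugr.
have [|z hz] := cpl r.
  move=> d; apply/ncF_ncfil; rewrite /= addrAC subrr sub0r.
  exact: (idealN (ncfil_ideal S d)).
exists z; apply/eqP; rewrite -subr_eq0; apply/eqP; apply: sep' => d.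
apply: (ideal_sub_trans (ncfil_ideal S d)) (rP d).
by rewrite -(alg_homB hu); apply: ncfil_hom => //; apply/ncF_ncfil.
Qed.

Section Uniqueness.
Variables (K : pzRingType) (A : algType K).
Hypothesis comA : commutative_alg A.

Lemma ab_iso_ker (S : algType K) (phi : S -> A) : ab_iso phi ->
  forall y, phi y = 0 <-> ncfil 1 y.
Proof.
move=> [_ _ kphi] y; rewrite kphi; split=> h; exact/ncfil1_comm_ideal.
Qed.

Lemma thickening_endo (S : algType K) (phi : S -> A) (u : S -> S) :
  nc_complete S -> ab_iso phi -> alg_hom u -> (forall y, phi (u y) = phi y) ->
  injective u /\ surj u.
Proof.
move=> cS iphi hu phiu; apply: unipotent_bijective => // y.
have [hphi _ _] := iphi.
by apply/(ab_iso_ker iphi); rewrite (alg_homB hphi) phiu subrr.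
Qed.

Variables (R1 R2 : algType K) (phi1 : R1 -> A) (phi2 : R2 -> A).
Hypotheses (iso1 : ab_iso phi1) (iso2 : ab_iso phi2).

(** Both composites are endomorphisms over [A], hence bijective; one gives injectivity of [psi], the
    other surjectivity. *)
Lemma thickening_iso (psi : R1 -> R2) (chi : R2 -> R1) :
  nc_complete R1 -> nc_complete R2 ->
  alg_hom psi -> (forall y, phi2 (psi y) = phi1 y) ->
  alg_hom chi -> (forall y, phi1 (chi y) = phi2 y) ->
  alg_iso psi.
Proof.
move=> c1 c2 hpsi psiE hchi chiE; split=> //.
have [inj _] : injective (chi \o psi) /\ surj (chi \o psi).
  apply: (thickening_endo c1 iso1); first exact: alg_hom_comp.
  by move=> y /=; rewrite chiE psiE.
have [_ sur] : injective (psi \o chi) /\ surj (psi \o chi).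
  apply: (thickening_endo c2 iso2); first exact: alg_hom_comp.
  by move=> y /=; rewrite psiE chiE.
have /choice [inv invK] : forall y, exists z, psi z = y.
  by move=> y; have [z <-] := sur y; exists (chi z).
exists inv => // y; apply: inj; congr (chi _); exact: invK.
Qed.

(** Smoothness of [R1] lifts [phi1] through [phi2], whose kernel is step 1 of [R2] and so is
    nilpotent. *)
Lemma d_smooth_hom d : d_smooth R1 d -> nc_nilpotent R2 d ->
  exists2 psi : R1 -> R2, alg_hom psi & forall y, phi2 (psi y) = phi1 y.
Proof.
move=> [_ n1 sm1] n2; have [h1 _ _] := iso1; have [h2 s2 _] := iso2.
have nA : nc_nilpotent A d by apply: commutative_nc_nilpotent.
have nk : nilpotent_pred (fun y : R2 => phi2 y = 0).
  exists d.+1 => a ha; apply: ((nc_nilpotentP _ _).1 n2).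
  apply: ncfilW (leq_pmulr _ (ltn0Sn 0)) (ncfil_prod _) => j.
  exact/(ab_iso_ker iso2).
have [|psi [hpsi _ psiE]] := sm1 _ _ _ n2 nA h2 s2 nk phi1 h1; last by exists psi.
by move=> y /n1 ->; apply: alg_hom0.
Qed.

(** Maps of sets that become homomorphisms modulo step [k]; successive approximations can thus be
    compared inside [R2] itself. *)
Definition hom_mod k (r : R1 -> R2) : Prop :=
  [/\ forall y z, ncfil k (r (y + z) - (r y + r z)),
      forall c y, ncfil k (r (c *: y) - c *: r y),
      forall y z, ncfil k (r (y * z) - r y * r z)
    & ncfil k (r 1 - 1)].

Lemma hom_modP k (r : R1 -> R2) (Q : algType K) (q : R2 -> Q) :
  alg_hom q -> (forall y, q y = 0 <-> ncfil k y) ->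
  hom_mod k r <-> alg_hom (q \o r).
Proof.
move=> hq kq.
have E y z : ncfil k (y - z) <-> q y = q z.
  split=> [/kq /(alg_hom_sub_eq0 hq)//|h]; apply/kq.
  by rewrite (alg_homB hq) h subrr.
split=> -[hD hZ hM h1]; split=> * /=.
- by rewrite -(alg_homD hq); apply/E.
- by rewrite -(alg_homZ hq); apply/E.
- by rewrite -(alg_homM hq); apply/E.
- by rewrite -(alg_hom1 hq); apply/E.
- by apply/E; rewrite (alg_homD hq); apply: hD.
- by apply/E; rewrite (alg_homZ hq); apply: hZ.
- by apply/E; rewrite (alg_homM hq); apply: hM.
- by apply/E; rewrite (alg_hom1 hq); apply: h1.
Qed.

(** The quotients of [R2] by steps [k.+2] and [k.+1] are both NC-nilpotent of degree [k.+1], and the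
    kernel between them has square zero as twice [k.+1] is at least [k.+2]. Smoothness of [R1] in
    that degree gives the lift. *)
Lemma hom_mod_lift k (r : R1 -> R2) : nc_smooth R1 -> hom_mod k.+1 r ->
  exists r', hom_mod k.+2 r' /\ forall y, ncfil k.+1 (r' y - r y).
Proof.
move=> [_ sm1] hr.
have n1 e : ~ ncfil e.+1 (1 : R2).
  have [h2 _ _] := iso2; move=> /(ncfilW (ltn0Sn e)) /(ab_iso_ker iso2) /eqP.
  by rewrite (alg_hom1 h2) oner_eq0.
have [Q [q [hq sq kq]]] := ideal_quotient (ncfil_ideal R2 k.+1) (n1 k).
have [Q' [q' [hq' sq' kq']]] := ideal_quotient (ncfil_ideal R2 k.+2) (n1 k.+1).
have [p hp pE] : exists2 p : Q' -> Q, alg_hom p & forall y, p (q' y) = q y.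
  by apply: factor_hom => // y /kq' /ncfilS /kq.
have sp : surj p by move=> y; have [w <-] := sq y; exists (q' w).
have nQ : nc_nilpotent Q k.+1.
  by apply: (nc_nilpotent_quotient hq sq) => y /ncfilS /kq.
have nQ' : nc_nilpotent Q' k.+1.
  by apply: (nc_nilpotent_quotient hq' sq') => y /kq'.
have np : nilpotent_pred (fun y : Q' => p y = 0).
  exists 2%N => a ha; rewrite big_ord_recl big_ord1.
  move: (ha ord0) (ha (lift ord0 ord0)).
  have [f <-] := sq' (a ord0); have [g <-] := sq' (a (lift ord0 ord0)).
  rewrite !pE -(alg_homM hq') => /kq hf /kq hg; apply/kq'.
  by apply: ncfilW (ncfil_mul hf hg); rewrite addSn addnS !ltnS leq_addl.
have hqr := (hom_modP r hq kq).1 hr.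
have [_ smk] := sm1 k.+1.
have [|g [hg _ gE]] := smk _ _ _ nQ' nQ hp sp np _ hqr.
  by move=> y /ncF_ncfil; apply: (ncfil_hom_eq0 hqr nQ).
have /choice [r' r'E] : forall y, exists z, q' z = g y by move=> y; apply: sq'.
exists r'; split.
  by apply/(hom_modP r' hq' kq'); have -> : q' \o r' = g by apply/funext.
by move=> y; apply/kq; rewrite (alg_homB hq) -pE r'E gE subrr.
Qed.

(** A set-theoretic lift of [phi1] through [phi2] is a homomorphism modulo step 1. Its refinements
    by [hom_mod_lift] converge by completeness, and separatedness makes the limit a homomorphism. *)
Lemma nc_smooth_hom : nc_smooth R1 -> nc_complete R2 ->
  exists2 psi : R1 -> R2, alg_hom psi & forall y, phi2 (psi y) = phi1 y.
Proof.
move=> sm1 [sep cpl]; have [h1 _ _] := iso1; have [h2 s2 _] := iso2.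
have /choice [r0 r0E] : forall y, exists z, phi2 z = phi1 y by move=> y; apply: s2.
have hr0 : hom_mod 1 r0.
  apply/(hom_modP r0 h2 (ab_iso_ker iso2)).
  by have -> : phi2 \o r0 = phi1 by apply/funext.
have /choice [next nextP] : forall kr : nat * (R1 -> R2), exists r',
    hom_mod kr.1.+1 kr.2 ->
    hom_mod kr.1.+2 r' /\ forall y, ncfil kr.1.+1 (r' y - kr.2 y).
  move=> [k r] /=; have [/(hom_mod_lift sm1) [r' hr']|nr] := pselect (hom_mod k.+1 r).
    by exists r'.
  by exists r.
pose rs := fix rs k := if k is e.+1 then next (e, rs e) else r0.
have hrs k : hom_mod k.+1 (rs k).
  by elim: k => [//|k IH]; have [] := nextP (k, rs k) IH.
have rsS k y : ncfil k.+1 (rs k.+1 y - rs k y).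
  by have [_] := nextP (k, rs k) (hrs k); apply.
have /choice [psi psiE] : forall y, exists z, forall k, ncfil k (z - rs k y).
  move=> y; have [|z hz] := cpl (fun k => rs k y).
    by move=> k; apply/ncF_ncfil; apply: ncfilS.
  by exists z => k; apply/ncF_ncfil.
have sep_eq (y z : R2) : (forall k, ncfil k (y - z)) -> y = z.
  move=> h; apply/eqP; rewrite -subr_eq0; apply/eqP; apply: sep => d.
  exact/ncF_ncfil.
have idN := ncfil_ideal R2.
exists psi => [|y]; last first.
  rewrite -r0E; apply: (alg_hom_sub_eq0 h2); apply/(ab_iso_ker iso2).
  exact: (ideal_sub_trans (idN 1%N) (psiE y 1%N)).
split=> [y z|c y|y z|]; apply: sep_eq => k.
- have [hD _ _ _] := hrs k.
  apply: (ideal_sub_trans (idN k) (psiE _ k)).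
  apply: (ideal_sub_trans (idN k) (ncfilS (hD y z))).
  by apply: (ideal_subD (idN k)); apply: (ideal_subC (idN k)).
- have [_ hZ _ _] := hrs k.
  apply: (ideal_sub_trans (idN k) (psiE _ k)).
  apply: (ideal_sub_trans (idN k) (ncfilS (hZ c y))).
  by apply: (ideal_subZ (idN k)); apply: (ideal_subC (idN k)).
- have [_ _ hM _] := hrs k.
  apply: (ideal_sub_trans (idN k) (psiE _ k)).
  apply: (ideal_sub_trans (idN k) (ncfilS (hM y z))).
  by apply: (ideal_subM (idN k)); apply: (ideal_subC (idN k)).
- have [_ _ _ h] := hrs k.
  exact: (ideal_sub_trans (idN k) (psiE _ k) (ncfilS h)).
Qed.

End Uniqueness.

(** * Presentation of the commutative algebra and conclusion *)

Lemma free_presentation (K : pzRingType) (A : algType K) : fin_gen A ->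
  exists (n : nat) (F : algType K) (x : 'I_n -> F) (pi : F -> A),
    [/\ is_free x, alg_hom pi & surj pi].
Proof.
move=> [g gA]; have [F [x freeF]] := free_alg_exists (size g) A.
have [pi hpi piE] := freeF.2 A (fun i => nth 0 g i).
exists (size g), F, x, pi; split=> // a.
elim: (gA a) => {a} [a ga||a b _ [f <-] _ [h <-]|c a _ [f <-]|a b _ [f <-] _ [h <-]].
- have ig : (index a g < size g)%N by rewrite index_mem.
  by exists (x (Ordinal ig)); rewrite piE nth_index.
- by exists 1; apply: alg_hom1.
- by exists (f + h); apply: alg_homD.
- by exists (c *: f); apply: alg_homZ.
- by exists (f * h); apply: alg_homM.
Qed.

Theorem theorem1p6p1 (Rr : realType) (A : comAlgType Rr[i]) :
  smooth_comm A ->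
  (* (a) *)
  (forall d : nat,
     (exists (R : algType Rr[i]) (phi : R -> A), d_smooth R d /\ ab_iso phi) /\
     (forall (R1 R2 : algType Rr[i]) (phi1 : R1 -> A) (phi2 : R2 -> A),
        d_smooth R1 d -> ab_iso phi1 -> d_smooth R2 d -> ab_iso phi2 ->
        exists psi : R1 -> R2, alg_iso psi /\ forall x, phi2 (psi x) = phi1 x)) /\
  (* (b) *)
  ((exists (R : algType Rr[i]) (phi : R -> A), nc_smooth R /\ ab_iso phi) /\
   (forall (R1 R2 : algType Rr[i]) (phi1 : R1 -> A) (phi2 : R2 -> A),
      nc_smooth R1 -> ab_iso phi1 -> nc_smooth R2 -> ab_iso phi2 ->
      exists psi : R1 -> R2, alg_iso psi /\ forall x, phi2 (psi x) = phi1 x)).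
Proof.
move=> smA; have [comA fgA _] := smA.
have [n [F [x [pi [freeF hpi spi]]]]] := free_presentation fgA.
have [J [thJ JS Jgap]] := thickening_chain comA hpi freeF spi smA.
split=> [d|]; split.
- exact: (d_smooth_quotient comA hpi freeF spi (thJ d)).
- move=> R1 R2 phi1 phi2 sm1 iso1 sm2 iso2.
  have [[_ n1 _] [_ n2 _]] := (sm1, sm2).
  have [psi hpsi psiE] := d_smooth_hom comA iso1 iso2 sm1 n2.
  have [chi hchi chiE] := d_smooth_hom comA iso2 iso1 sm2 n1.
  exists psi; split=> //.
  by apply: (thickening_iso iso1 iso2 _ _ hpsi psiE hchi chiE);
    apply: nc_nilpotent_complete; eassumption.
- have [R [c [Z limR]]] := limit_exists hpi thJ JS.
  have [phi iphi] := limit_ab_iso hpi freeF thJ Jgap limR spi.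
  exists R, phi; split=> //; split; first exact: (limit_nc_complete hpi freeF thJ Jgap limR).
  exact: (limit_smooth hpi freeF thJ Jgap limR).
- move=> R1 R2 phi1 phi2 sm1 iso1 sm2 iso2.
  have [[c1 _] [c2 _]] := (sm1, sm2).
  have [psi hpsi psiE] := nc_smooth_hom iso1 iso2 sm1 c2.
  have [chi hchi chiE] := nc_smooth_hom iso2 iso1 sm2 c1.
  by exists psi; split=> //; apply: (thickening_iso iso1 iso2 c1 c2 hpsi psiE hchi chiE).
Qed.
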